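(* Let $\varphi,\phi:\Omega\to\Omega$ and $u\in BV(\Omega)$. Assume that there are maps $\Phi^s:\Omega\to\Omega$, $0\le s\le1$, with $$\Phi^0(x)=\phi(x),\qquad\Phi^1(x)=\varphi(x)\qquad\text{for all }x\in\Omega,$$ which are measurable and differentiable with respect to $s$, such that $$\Phi^s_*\lambda(A)\le c\,\lambda(A)\qquad\text{for all }A\in\mathcal{A}\text{ and }0\le s\le1$$ and $$\sup_{0\le s\le1,\ x\in\Omega}|\partial_s\Phi^s(x)|\le C\,\|\phi-\varphi\|_{L_\infty(\Omega)}$$ for constants $c,C\ge0$. Then $$\|u\circ\phi-u\circ\varphi\|_{L_1(\Omega)}\le c\,C\,\|u\|_{BV(\Omega)}\,\|\phi-\varphi\|_{L_\infty(\Omega)}.$$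
   Context: $\Omega\subset\mathbb{R}^N$ is a domain (open set), $\lambda$ is the Lebesgue measure and $\mathcal{A}$ the Lebesgue $\sigma$-algebra on $\Omega$. The pushforward measure is $\Phi^s_*\lambda(A)=\lambda((\Phi^s)^{-1}(A))$ for $A\in\mathcal{A}$. $BV(\Omega)$ is the space of real-valued functions of bounded variation on $\Omega$ with its usual norm (the $L_1$-norm plus the total variation). $|\cdot|$ is the Euclidean norm on $\mathbb{R}^N$. *)

(* Defs.v *)
From HB Require Import structures.
From mathcomp Require Import all_boot all_order all_algebra.
From mathcomp Require Import all_classical all_reals all_analysis.

Set Implicit Arguments.
Unset Strict Implicit.
Unset Printing Implicit Defensive.

Import Order.TTheory GRing.Theory Num.Theory.
Import numFieldNormedType.Exports.

Local Open Scope classical_set_scope.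
Local Open Scope ring_scope.

(* R^n, n >= 1, is 'rV[R]_N.+1. The library norm on row vectors is the maximum
   norm; it is used here only for its topology. *)
Definition enorm (R : realType) (n : nat) (x : 'rV[R]_n) : R :=
  Num.sqrt (\sum_(i < n) x 0 i ^+ 2).

Section lebesgue_measure_rV.
Local Open Scope ereal_scope.
Context (R : realType) (N : nat).
Local Notation V := 'rV[R]_N.+1.

(* The box with opposite corners ab.1 and ab.2, empty unless ab.1 < ab.2
   coordinatewise. *)
Definition box (ab : V * V) : set V :=
  [set x | forall i, x 0%R i \in `]ab.1 0%R i, ab.2 0%R i]%R].

Definition box_volume (ab : V * V) : \bar R :=
  (\prod_(i < N.+1) Num.max (ab.2 0 i - ab.1 0 i) 0)%R%:E.

Definition box_cover (X : set V) : set ((V * V)^nat) :=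
  [set F | X `<=` \bigcup_k box (F k)].

Definition lebesgue_outer (X : set V) : \bar R :=
  ereal_inf [set \sum_(k <oo) box_volume (F k) | F in box_cover X].

Lemma box_volume_ge0 ab : 0 <= box_volume ab.
Proof. by rewrite lee_fin prodr_ge0// => i _; rewrite le_max lexx orbT. Qed.

Lemma le_lebesgue_outer : {homo lebesgue_outer : A B / A `<=` B >-> A <= B}.
Proof.
move=> A B AB; apply/ereal_inf_le_tmp => x [F BF] <-{x}.
by exists F => //; exact: subset_trans AB BF.
Qed.

Lemma lebesgue_outer_ge0 A : 0 <= lebesgue_outer A.
Proof.
apply: le_ereal_inf_tmp => x [F _ <-{x}].
by apply: nneseries_ge0 => *; exact: box_volume_ge0.
Qed.

Lemma lebesgue_outer0 : lebesgue_outer set0 = 0.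
Proof.
apply/eqP; rewrite eq_le lebesgue_outer_ge0 andbT.
apply: ereal_inf_lbound; exists (fun=> (0%R, 0%R)); first exact: sub0set.
rewrite eseries0// => i _ _.
by rewrite /box_volume big_ord_recl subrr maxxx mul0r.
Qed.

Lemma lebesgue_outer_sigma_subadditive : sigma_subadditive lebesgue_outer.
Proof.
move=> A; have [[i ioo]|] := pselect (exists i, lebesgue_outer (A i) = +oo).
  rewrite (eseries_pinfty _ _ ioo) ?leey// => n _.
  by rewrite -ltNye (lt_le_trans _ (lebesgue_outer_ge0 _)).
rewrite -forallNE => Aoo.
suff add2e (e : {posnum R}) : lebesgue_outer (\bigcup_n A n) <=
    \sum_(i <oo) lebesgue_outer (A i) + e%:num%:E.
  by apply/lee_addgt0Pr => _/posnumP[].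
rewrite (le_trans _ (epsilon_trick _ _ _))//; last first.
  by move=> n; exact: lebesgue_outer_ge0.
pose P n (F : (V * V)^nat) := box_cover (A n) F /\
  \sum_(k <oo) box_volume (F k) <=
    lebesgue_outer (A n) + (e%:num / (2 ^ n.+1)%:R)%:E.
have [G PG] : {G : ((V * V)^nat)^nat & forall n, P n (G n)}.
  apply: (@choice _ _ P) => n.
  have fA : lebesgue_outer (A n) \is a fin_num.
    by rewrite ge0_fin_numE ?lebesgue_outer_ge0// ltey; apply/eqP/Aoo.
  have en1 : (0 < e%:num / (2 ^ n.+1)%:R)%R by [].
  have [_ [F AF <-] ltF] := lb_ereal_inf_adherent en1 fA.
  by exists F; split => //; exact: ltW.
have v0 k : 0 <= (box_volume \o uncurry G) k by exact: box_volume_ge0.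
apply: (@le_trans _ _ (\esum_(i in setT) (box_volume \o uncurry G) i)).
  have /card_esym/ppcard_eqP[f] := card_nat2.
  apply: ereal_inf_lbound; exists (uncurry G \o f).
    move=> t [n _ /(PG n).1 [k _ Gt]]; exists (f^-1%FUN (n, k)) => //=.
    by rewrite invK ?inE.
  rewrite -(esum_pred_image (box_volume \o uncurry G) _ xpredT)
    ?[fun=> _]set_true//.
  by rewrite image_eq.
rewrite (_ : esum _ _ = \sum_(i <oo) \sum_(j <oo) box_volume (G i j)).
  apply: lee_nneseries => n *; last exact: (PG n).2.
  by apply: nneseries_ge0 => *; exact: box_volume_ge0.
rewrite (_ : setT = \bigcup_k (pair k @` setT)); last first.
  by rewrite predeqE => -[a b]; split => // _; exists a => //; exists b.
rewrite esum_bigcupT //=; first last.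
- apply/trivIsetP => i j _ _ ij; rewrite predeqE => -[n m] /=; split => //=.
  by move=> [[k _ [<- _]] [l _ [ji _]]]; move: ij; rewrite ji eqxx.
rewrite -(image_id [set: nat]) -fun_true esum_pred_image//; last first.
  by move=> n _; apply: esum_ge0 => ? _; exact: box_volume_ge0.
apply: eq_eseriesr => /= j _.
rewrite -(esum_pred_image (box_volume \o uncurry G) (pair j) predT)/=.
- by rewrite image_id.
- by move=> *; exact: box_volume_ge0.
- by move=> ? ? _ _ [].
Qed.

HB.instance Definition _ := isOuterMeasure.Build R V lebesgue_outer
  lebesgue_outer0 lebesgue_outer_ge0 le_lebesgue_outer
  lebesgue_outer_sigma_subadditive.

(* R^N.+1 with the Lebesgue sigma-algebra (complete, hence larger than the
   Borel one) and the Lebesgue measure. *)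
Definition lebesgue_rV := caratheodory_type lebesgue_outer.
HB.instance Definition _ := Measurable.on lebesgue_rV.

Definition lebesgue : set lebesgue_rV -> \bar R := lebesgue_outer.
HB.instance Definition _ := isMeasure.Build _ lebesgue_rV R lebesgue
  (@caratheodory_measure0 R V lebesgue_outer)
  (@caratheodory_measure_ge0 R V lebesgue_outer)
  (@caratheodory_measure_sigma_additive R V lebesgue_outer).

End lebesgue_measure_rV.
Arguments lebesgue {R N}.

Section function_spaces_on_open_sets.
Local Open Scope ereal_scope.
Context (R : realType) (N : nat).
Local Notation V := 'rV[R]_N.+1.
Implicit Types (Omega : set V) (u : V -> R).

Definition Lp_norm Omega (p : \bar R) u : \bar R :=
  Lnorm (lebesgue : {measure set (lebesgue_rV R N) -> \bar R}) p
    ((EFin \o u) \_ Omega).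

Definition C1c_field Omega (psi : V -> V) : Prop :=
  [/\ forall i x, derivable psi x (delta_mx 0%R i),
      forall i, continuous ('D_(delta_mx 0%R i) psi),
      compact (closure [set x | psi x != 0%R]) &
      closure [set x | psi x != 0%R] `<=` Omega].

Definition divergence (psi : V -> V) (x : V) : R :=
  (\sum_(i < N.+1) ('D_(delta_mx 0 i) psi x) 0 i)%R.

Definition total_variation Omega u : \bar R :=
  ereal_sup [set \int[lebesgue]_(x in (Omega : set (lebesgue_rV R N)))
                   (u x * divergence psi x)%:E |
             psi in [set psi | C1c_field Omega psi /\
                               forall x, (enorm (psi x) <= 1)%R]].

Definition BV Omega u : Prop :=
  lebesgue.-integrable (Omega : set (lebesgue_rV R N)) (EFin \o u) /\
  total_variation Omega u < +oo.

Definition BV_norm Omega u : \bar R :=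
  Lp_norm Omega 1 u + total_variation Omega u.

End function_spaces_on_open_sets.

(* Derivative relative to a set D of parameters, one-sided at endpoints. *)
Section derivative_within.
Context (R : realType) (W : normedModType R).

Definition derivable_within (D : set R) (f : R -> W) (s : R) : Prop :=
  cvg ((fun t => (t - s)^-1 *: (f t - f s)) @ within D s^').

Definition derive_within (D : set R) (f : R -> W) (s : R) : W :=
  lim ((fun t => (t - s)^-1 *: (f t - f s)) @ within D s^').

End derivative_within.

(* Main.v *)
Require Import Defs.
From HB Require Import structures.
From mathcomp Require Import all_boot all_order all_algebra.
From mathcomp Require Import all_classical all_reals all_analysis.
From mathcomp Require Import measurable_realfun.
From mathcomp Require Import ring lra.

Set Implicit Arguments.
Unset Strict Implicit.
Unset Printing Implicit Defensive.

Import Order.TTheory GRing.Theory Num.Theory.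
Import numFieldNormedType.Exports.

Local Open Scope classical_set_scope.
Local Open Scope ring_scope.

(** Why the estimate holds. Put M = C * ||phi - vphi||_oo. Each trajectory
    s |-> Phi s x is M-Lipschitz, so for a smooth function U the increment
    U (Phi 1 x) - U (Phi 0 x) is bounded by M times the average over s of
    |grad U| (Phi s x). Integrating in x, the bound on the push-forward measures
    replaces the integral of |grad U| (Phi s x) by c times that of |grad U|,
    and one is left with M * c times the variation of U.

    A function u of bounded variation is replaced by its mollifications
    U = u * moll e, where moll e x = max (e^2 - |x|^2, 0)^2 has mass mass N e.
    Three facts carry the passage from U to u.

    - Localisation. Mollifying is harmless only away from the boundary of Omega.
      A trajectory is compact in Omega, so it stays in one of the sets
      inner Omega j, at distance at least of order 1 / j from the complement; the
      sets stay Omega Phi j of points with such a trajectory increase to Omega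
      (bigcup_stay). It therefore suffices to prove the estimate on each of
      them, with a bound that does not depend on j.

    - Variation. On inner Omega j the integral of |grad U| is at most
      mass N e times the total variation of u (mollify_gradient_le). Indeed
      the field opposite to grad U / |grad U|, restricted to inner Omega j and
      mollified in turn, is an admissible test field for u once e is small with
      respect to j, and the gradient of the mollification is, up to sign, its own
      adjoint (dmollify_adjoint, an instance of Fubini).

    - Convergence. U / mass N e tends to u in L^1 (integrable_mollifiable), hence
      so do the compositions with Phi 0 and Phi 1, again by the bound on the
      push-forward measures (integral_comp_le).

    The integral over s is replaced by a sum over the time grid k / n:
    the gradient of the kernel is Lipschitz, so U has a quadratic Taylor
    remainder (mollify_taylor), and the n remainders of size (M / n)^2 disappear
    as n tends to infinity (integral_mollify_flow_le). In this way only the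
    measurability of each single map Phi s enters.

    The factor mass N e is divided out at the end. It is positive unless the
    whole space is a null set (mass_eq0), in which case there is nothing to
    prove.

    When C * ||phi - vphi||_oo is infinite the claim is trivial unless
    c * ||u||_BV vanishes, and then both compositions vanish almost everywhere
    (Lp_norm1_comp_le). *)


(** * Borel sets and translations for the Lebesgue measure *)

Section lebesgue_rV_theory.
Context (R : realType) (N : nat).
Local Notation V := 'rV[R]_N.+1.
Local Notation L := (lebesgue_rV R N).
Local Notation mu := (@lebesgue R N : {measure set L -> \bar R}).

Lemma rV_coord_le_norm (x : V) i : `|x 0 i| <= `|x|.
Proof.
rewrite [leRHS]/Num.Def.normr/= mx_normrE.
exact: (le_bigmax _ (fun ij : 'I_1 * 'I_N.+1 => `|x ij.1 ij.2|) (0, i)).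
Qed.

Lemma rV_norm_le (x : V) e : 0 <= e -> (forall i, `|x 0 i| <= e) -> `|x| <= e.
Proof.
move=> e0 xe; rewrite [leLHS]/Num.Def.normr/= mx_normrE.
by apply: bigmax_le => // -[i j] _ /=; rewrite ord1.
Qed.

Lemma rV_norm_lt (x : V) e : 0 < e -> (forall i, `|x 0 i| < e) -> `|x| < e.
Proof.
move=> e0 xe; rewrite [ltLHS]/Num.Def.normr/= mx_normrE.
by apply: bigmax_lt => // -[i j] _ /=; rewrite ord1.
Qed.

(** box_below and box_above are the two parts into which the hyperplane x_i = a
    cuts a box. *)
Definition box_below (i : 'I_N.+1) (a : R) (ab : V * V) : V * V :=
  (ab.1, \row_j if j == i then Num.min (ab.2 0 j) a else ab.2 0 j).

Definition box_above (i : 'I_N.+1) (a : R) (ab : V * V) : V * V :=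
  (\row_j if j == i then Num.max (ab.1 0 j) a else ab.1 0 j, ab.2).

Lemma box_volume_cut i a ab :
  (box_volume (box_below i a ab) + box_volume (box_above i a ab) =
   box_volume ab)%E.
Proof.
rewrite /box_volume -EFinD; congr (_%:E).
rewrite (bigD1 i)//= [X in _ + X](bigD1 i)//= [RHS](bigD1 i)//=.
rewrite !mxE !eqxx.
under [X in _ * X + _]eq_bigr => j ji do rewrite mxE (negbTE ji).
under [X in _ + _ * X]eq_bigr => j ji do rewrite mxE (negbTE ji).
rewrite -mulrDl; congr (_ * _).
rewrite /Num.min /Num.max; repeat case: ifPn => //; rewrite -?leNgt; lra.
Qed.

(** Cutting every box of a cover along the hyperplane gives covers of the two
    parts of a set without changing the total volume. *)
Lemma measurable_halfspace i a : measurable ([set x : V | x 0 i <= a] : set L).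
Proof.
apply: le_caratheodory_measurable => X.
apply: le_ereal_inf_tmp => _ [F XF <-].
have -> : (\sum_(k <oo) box_volume (F k) =
    \sum_(k <oo) box_volume (box_below i a (F k)) +
    \sum_(k <oo) box_volume (box_above i a (F k)))%E.
  rewrite -nneseriesD//; try by move=> *; exact: box_volume_ge0.
  by apply: eq_eseriesr => k _; rewrite box_volume_cut.
apply: leeD.
- apply: ereal_inf_lbound; exists (fun k => box_below i a (F k)) => //.
  move=> x [/XF[k _ Fx] /= xa]; exists k => // j.
  have /[!in_itv]/= /andP[x1 x2] := Fx j.
  rewrite x1/= mxE; case: eqP => [->//|//].
  by rewrite le_min xa andbT; have /[!in_itv]/= /andP[] := Fx i.
- apply: ereal_inf_lbound; exists (fun k => box_above i a (F k)) => //.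
  move=> x [/XF[k _ Fx] /= /negP]; rewrite -ltNge => xa; exists k => // j.
  have /[!in_itv]/= /andP[x1 x2] := Fx j.
  rewrite x2 andbT mxE; case: eqP => [->//|//].
  by rewrite gt_max xa andbT; have /[!in_itv]/= /andP[] := Fx i.
Qed.

Lemma measurable_coord (i : 'I_N.+1) (D : set L) :
  measurable_fun D (fun x : L => (x : V) 0 i).
Proof.
apply: measurable_funTS.
apply: (measurability _ (RGenOInfty.measurableE R)) => _ [_ [a ->] <-].
rewrite setTI (_ : _ @^-1` _ = ~` [set x : V | x 0 i <= a]).
  exact/measurableC/measurable_halfspace.
by apply/seteqP; split => x /=; rewrite in_itv/= andbT ltNge => /negP.
Qed.

Lemma measurable_box (ab : V * V) : measurable (box ab : set L).
Proof.
have -> : box ab = \bigcap_(i in [set: 'I_N.+1])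
    ((fun x : L => (x : V) 0 i) @^-1` `]ab.1 0 i, ab.2 0 i]%classic).
  apply/seteqP; split => x /= h.
    by move=> i _; exact: h.
  by move=> i; exact: (h i).
apply: fin_bigcap_measurable => // i _; rewrite -[X in measurable X]setTI.
exact: measurable_coord.
Qed.

Lemma lebesgue_box_le (ab : V * V) : (mu (box ab) <= box_volume ab)%E.
Proof.
apply: ereal_inf_lbound.
exists (fun k : nat => if k == 0%N then ab else (0, 0)).
  by move=> x abx; exists 0%N.
rewrite nneseries_recl//; last by move=> *; exact: box_volume_ge0.
rewrite eseries0 ?adde0// => -[|k]// _ _.
by rewrite /box_volume big_ord_recl subrr maxxx mul0r.
Qed.

Lemma lebesgue_box_lty (ab : V * V) : (mu (box ab) < +oo)%E.
Proof. by rewrite (le_lt_trans (lebesgue_box_le _))// ltry. Qed.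

Definition cube (r : R) : set V := box (\row__ - r, \row__ r).

Lemma cube_norm (r : R) (x : V) : `|x| < r -> cube r x.
Proof.
move=> xr i; rewrite in_itv/= !mxE.
have := le_lt_trans (rV_coord_le_norm x i) xr.
by rewrite ltr_norml => /andP[-> /ltW].
Qed.

Lemma bigcup_cube : \bigcup_k cube k%:R = [set: V].
Proof.
rewrite -subTset => x _; exists (Num.bound `|x|) => //.
by apply: cube_norm; exact: archi_boundP.
Qed.

Lemma lebesgue_sigma_finite : sigma_finite setT mu.
Proof.
exists (fun k => cube k%:R); first by rewrite bigcup_cube.
by move=> k; split; [exact: measurable_box|exact: lebesgue_box_lty].
Qed.

HB.instance Definition _ := @Measure_isSigmaFinite.Build _ _ _ (@lebesgue R N)
  lebesgue_sigma_finite.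

(** An open set is a countable union of cubes with rational centres and radii
    1 / (k + 1). *)
Lemma measurable_open (A : set V) : open A -> measurable (A : set L).
Proof.
move=> oA.
pose Q (qk : 'rV[rat]_N.+1 * nat) : set V :=
  [set x | forall i, `|x 0 i - ratr (qk.1 0 i)| < qk.2.+1%:R^-1].
have mQ qk : measurable (Q qk : set L).
  have -> : Q qk = \bigcap_(i in [set: 'I_N.+1])
      ((fun x : L => `|(x : V) 0 i - ratr (qk.1 0 i)|) @^-1`
        `]-oo, qk.2.+1%:R^-1[%classic).
    apply/seteqP; split => x /= h.
      by move=> i _ /=; rewrite in_itv/=; exact: h.
    by move=> i; have /= := h i I; rewrite in_itv.
  apply: fin_bigcap_measurable => // i _; rewrite -[X in measurable X]setTI.
  have mf : measurable_fun [set: L]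
      (fun x : L => `|(x : V) 0 i - ratr (qk.1 0 i)|).
    have mg : measurable_fun [set: L] (fun x : L => (x : V) 0 i - ratr (qk.1 0 i)).
      by apply: measurable_funB; [exact: measurable_coord|exact: measurable_cst].
    exact: (measurableT_comp (@normr_measurable R setT) mg).
  exact: mf.
have -> : A = \bigcup_qk (if `[< Q qk `<=` A >] then Q qk else set0).
  apply/seteqP; split => [x Ax|x [qk _]]; last by case: asboolP => // + Qx; exact.
  have /nbhs_ballP[e /= e0 eA] : nbhs x A by exact: open_nbhs_nbhs.
  (* both points below are within 1 / (k + 1) of the centre of the cube *)
  have [k ke] : exists k, k.+1%:R^-1 < e / 2.
    exists (Num.bound (e / 2)^-1).
    rewrite invf_plt ?posrE ?divr_gt0// (lt_trans (archi_boundP _))//.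
      by rewrite invr_ge0 ltW// divr_gt0.
    by rewrite ltr_nat.
  have k0 : 0 < k.+1%:R^-1 :> R by [].
  have /choice[q qx] i : exists q, `|x 0 i - ratr q| < k.+1%:R^-1.
    have /rat_in_itvoo[q /itvP qx] : x 0 i < x 0 i + k.+1%:R^-1.
      by rewrite ltrDl.
    exists q; rewrite distrC ltr_distl qx andbT.
    by rewrite (@lt_trans _ _ (x 0 i)) ?qx// gtrBl.
  exists (\row_i q i, k) => //.
  case: asboolP => [_ i/=|]; first by rewrite mxE qx.
  case=> y Qy; apply: eA; rewrite -ball_normE/=.
  apply: rV_norm_lt => // i; rewrite !mxE.
  have := Qy i; rewrite /= mxE => yq.
  rewrite (splitr e) -(subrKA (ratr (q i))).
  rewrite (le_lt_trans (ler_normD _ _))// ltrD// (lt_trans _ ke)//.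
  by rewrite distrC.
apply: countable_bigcupT_measurable => // qk.
by case: ifP => _ //.
Qed.

Lemma measurable_continuous (f : V -> R) (D : set L) :
  continuous f -> measurable_fun D (f : L -> R).
Proof.
move=> /continuousP cf; apply: measurable_funTS.
apply: (measurability _ (RGenOpens.measurableE R)) => _ [_ [a [b ->]] <-].
by rewrite setTI; apply/measurable_open/cf; exact: interval_open.
Qed.

Let le_lebesgue_outer_shift (a : V) (A : set V) :
  (lebesgue_outer [set x | A (x + a)%R] <= lebesgue_outer A)%E.
Proof.
apply: le_ereal_inf_tmp => _ [F AF <-].
apply: ereal_inf_lbound.
exists (fun k => ((F k).1 - a, (F k).2 - a)).
  move=> x /AF[k _ Fx]; exists k => // i; have := Fx i.
  by rewrite !in_itv/= !mxE ltrBlDr lerBrDr.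
apply: eq_eseriesr => k _; rewrite /box_volume/=; congr (_%:E).
by apply: eq_bigr => i _; rewrite !mxE opprB addrA subrK.
Qed.

Lemma lebesgue_outer_shift (a : V) (A : set V) :
  lebesgue_outer [set x | A (x + a)] = lebesgue_outer A.
Proof.
apply/eqP; rewrite eq_le le_lebesgue_outer_shift/=.
have := le_lebesgue_outer_shift (- a) [set x | A (x + a)].
rewrite [X in (lebesgue_outer X <= _)%E](_ : _ = A)//.
by apply/seteqP; split => x /=; rewrite subrK.
Qed.

Lemma measurable_shift (a : V) :
  measurable_fun setT (fun x : L => (x + a : V) : L).
Proof.
move=> _ A mA; rewrite setTI.
suff h : (@lebesgue_outer R N).-caratheodory [set x : V | A (x + a)] by exact: h.
have {}mA : (@lebesgue_outer R N).-caratheodory A by exact: mA.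
move=> X; rewrite -(lebesgue_outer_shift (- a)) mA.
by congr +%E; rewrite -[RHS](lebesgue_outer_shift (- a));
  congr lebesgue_outer; apply/seteqP; split => x /=; rewrite subrK.
Qed.

Lemma ge0_integral_shift (a : V) (f : V -> \bar R) :
  measurable_fun setT (f : L -> \bar R) -> (forall x, 0 <= f x)%E ->
  (\int[mu]_x f (x + a)%R = \int[mu]_x f x)%E.
Proof.
move=> mf f0.
pose sh : L -> L := fun x => (x + a : V).
have msh : measurable_fun setT sh by exact: measurable_shift.
transitivity (\int[pushforward mu sh]_x f x)%E.
  by rewrite (ge0_integral_pushforward msh mu measurableT mf) ?preimage_setT.
apply: (@eq_measure_integral _ L R setT mu (pushforward mu sh)) => A mA _.
exact: (lebesgue_outer_shift a A).
Qed.

End lebesgue_rV_theory.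

(** * The Euclidean norm *)

Section euclidean.
Context (R : realType) (N : nat).
Local Notation V := 'rV[R]_N.
Implicit Types x y w : V.

Definition dot x y : R := \sum_i x 0 i * y 0 i.

Lemma dotC x y : dot x y = dot y x.
Proof. by apply: eq_bigr => i _; rewrite mulrC. Qed.

Lemma dotDr x y w : dot x (y + w) = dot x y + dot x w.
Proof. by rewrite -big_split; apply: eq_bigr => i _; rewrite mxE mulrDr. Qed.

Lemma dotZr a x y : dot x (a *: y) = a * dot x y.
Proof. by rewrite mulr_sumr; apply: eq_bigr => i _; rewrite mxE mulrCA. Qed.

Lemma dotNr x y : dot x (- y) = - dot x y.
Proof. by rewrite -scaleN1r dotZr mulN1r. Qed.

Lemma dot_ge0 x : 0 <= dot x x.
Proof. by apply: sumr_ge0 => i _; rewrite -expr2 sqr_ge0. Qed.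

Lemma enormE x : enorm x = Num.sqrt (dot x x).
Proof. by congr Num.sqrt; apply: eq_bigr => i _; rewrite expr2. Qed.

Lemma enorm_ge0 x : 0 <= enorm x.
Proof. exact: sqrtr_ge0. Qed.

Lemma sqr_enorm x : enorm x ^+ 2 = dot x x.
Proof. by rewrite enormE sqr_sqrtr// dot_ge0. Qed.

Lemma dotDD x y : dot (x + y) (x + y) = dot x x + 2 * dot x y + dot y y.
Proof. by rewrite dotDr !(dotC (x + y)) !dotDr (dotC y x); ring. Qed.

Lemma dot_sqr_le x y : dot x y ^+ 2 <= dot x x * dot y y.
Proof.
have : 0 <= \sum_i \sum_j (x 0 i * y 0 j - x 0 j * y 0 i) ^+ 2.
  by apply: sumr_ge0 => i _; apply: sumr_ge0 => j _; rewrite sqr_ge0.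
have -> : \sum_i \sum_j (x 0 i * y 0 j - x 0 j * y 0 i) ^+ 2 =
    dot x x * dot y y + dot x x * dot y y - 2 * dot x y ^+ 2.
  rewrite {2}(mulrC (dot x x)) expr2 {1 2 3}/dot.
  rewrite !big_distrlr/= mulr_sumr -sumrN -!big_split/=; apply: eq_bigr => i _.
  rewrite mulr_sumr -sumrN -!big_split/=; apply: eq_bigr => j _.
  ring.
lra.
Qed.

Lemma dot_le x y : dot x y <= enorm x * enorm y.
Proof.
have [xy0|xy0] := leP (dot x y) 0.
  by rewrite (le_trans xy0)// mulr_ge0// enorm_ge0.
rewrite -(@ler_pXn2r _ 2) ?nnegrE ?mulr_ge0 ?enorm_ge0 ?(ltW xy0)//.
by rewrite exprMn !sqr_enorm dot_sqr_le.
Qed.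

Lemma enormN x : enorm (- x) = enorm x.
Proof. by rewrite !enormE dotNr dotC dotNr opprK. Qed.

Lemma enormZ a x : enorm (a *: x) = `|a| * enorm x.
Proof.
rewrite !enormE dotZr dotC dotZr mulrA -expr2 sqrtrM ?sqr_ge0//.
by rewrite sqrtr_sqr.
Qed.

Lemma enorm0 : enorm (0 : V) = 0.
Proof. by rewrite -(scale0r 0) enormZ normr0 mul0r. Qed.

Lemma dot_norm_le x y : `|dot x y| <= enorm x * enorm y.
Proof.
rewrite ler_norml dot_le andbT lerNl -dotNr (le_trans (dot_le _ _))//.
by rewrite enormN.
Qed.

Lemma enormD x y : enorm (x + y) <= enorm x + enorm y.
Proof.
rewrite -(@ler_pXn2r _ 2) ?nnegrE ?addr_ge0 ?enorm_ge0//.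
rewrite sqrrD !sqr_enorm dotDD lerD2r lerD2l mulr2n.
have := dot_le x y; lra.
Qed.

Lemma coord_le_enorm x i : `|x 0 i| <= enorm x.
Proof.
rewrite -sqrtr_sqr /enorm ler_wsqrtr// (bigD1 i)//= lerDl.
by apply: sumr_ge0 => j _; rewrite sqr_ge0.
Qed.

(** Used to bound the norm of a vector-valued integral by a scalar one. *)
Lemma enorm_le_dot x a : 0 <= a ->
  (forall w, enorm w <= 1 -> dot w x <= a) -> enorm x <= a.
Proof.
move=> a0 xa; have [x0|x0] := eqVneq (enorm x) 0; first by rewrite x0.
have := xa ((enorm x)^-1 *: x).
rewrite enormZ ger0_norm ?invr_ge0 ?enorm_ge0// mulVf// => /(_ (lexx _)).
by rewrite dotC dotZr -sqr_enorm expr2 mulrA mulVf// mul1r.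
Qed.

Lemma enorm_le_sum x : enorm x <= \sum_i `|x 0 i|.
Proof.
apply: enorm_le_dot; first exact: sumr_ge0.
move=> w w1; apply: ler_sum => i _.
rewrite (le_trans (ler_norm _))// normrM ler_piMl//.
exact: le_trans (coord_le_enorm _ _) w1.
Qed.

End euclidean.

(** * The mollifying kernel *)

Section moll.
Context (R : realType) (N : nat).
Local Notation V := 'rV[R]_N.+1.
Local Notation L := (lebesgue_rV R N).
Implicit Types (e : R) (x y w : V).

(** Squaring the positive part makes the kernel C^1 with a Lipschitz gradient,
    and this is all the smoothness that is used. *)
Definition pospart e x : R := Num.max (e ^+ 2 - dot x x) 0.

Definition moll e x : R := pospart e x ^+ 2.

Definition dmoll e x : V := (- 4 * pospart e x) *: x.

Lemma pospart_ge0 e x : 0 <= pospart e x.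
Proof. by rewrite /pospart le_max lexx orbT. Qed.

Lemma pospart_le e x : 0 <= e -> e <= 1 -> pospart e x <= 1.
Proof.
move=> e0 e1; rewrite /pospart ge_max ler01 andbT.
have := dot_ge0 x; have : e ^+ 2 <= 1 by rewrite expr_le1.
lra.
Qed.

Lemma pospart_gt0 e x : 0 <= e -> (0 < pospart e x) = (enorm x < e).
Proof.
move=> e0; rewrite /pospart lt_max ltxx orbF subr_gt0 -sqr_enorm.
by rewrite ltr_pXn2r// nnegrE enorm_ge0.
Qed.

Lemma pospart_eq0 e x : 0 <= e -> e <= enorm x -> pospart e x = 0.
Proof.
move=> e0 ex; apply/eqP; rewrite eq_le pospart_ge0 andbT leNgt pospart_gt0//.
by rewrite -leNgt.
Qed.

Lemma moll_ge0 e x : 0 <= moll e x. Proof. exact: sqr_ge0. Qed.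

Lemma moll_le1 e x : 0 <= e -> e <= 1 -> moll e x <= 1.
Proof. by move=> e0 e1; rewrite expr_le1// ?pospart_ge0// pospart_le. Qed.

Lemma moll_eq0 e x : 0 <= e -> e <= enorm x -> moll e x = 0.
Proof. by move=> e0 ex; rewrite /moll pospart_eq0// expr0n. Qed.

Lemma mollN e x : moll e (- x) = moll e x.
Proof. by rewrite /moll /pospart dotNr dotC dotNr opprK. Qed.

(** The quadratic e^2 - |x|^2 is not Lipschitz on the whole space, but it only
    matters where one of the two points lies in the support. *)
Lemma pospart_diff e y d : 0 <= e -> e <= 1 -> enorm d <= 1 ->
    enorm y < e \/ enorm (y + d) < e ->
  enorm y <= 2 /\ `|dot (y + d) (y + d) - dot y y| <= 5 * enorm d.
Proof.
move=> e0 e1 d1 yd.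
have y2 : enorm y <= 2.
  case: yd => yd; first lra.
  have := enormD (y + d) (- d); rewrite addrK enormN; lra.
split => //; rewrite dotDD.
rewrite (_ : _ - _ = 2 * dot y d + dot d d); last ring.
rewrite (le_trans (ler_normD _ _))// normrM.
have := dot_norm_le y d.
rewrite -sqr_enorm normr_nat (ger0_norm (sqr_ge0 _)).
have := enorm_ge0 d; have := enorm_ge0 y.
nra.
Qed.

Lemma pospart_lip e y d : 0 <= e -> e <= 1 -> enorm d <= 1 ->
  `|pospart e (y + d) - pospart e y| <= 5 * enorm d.
Proof.
move=> e0 e1 d1.
have [ye|ye] := ltP (enorm y) e; last have [yde|yde] := ltP (enorm (y + d)) e.
- have [|_] := @pospart_diff e y d e0 e1 d1; first by left.
  rewrite /pospart /Num.max !ler_norml.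
  by do 2 case: ifPn => //; rewrite -?leNgt; have := enorm_ge0 d; lra.
- have [|_] := @pospart_diff e y d e0 e1 d1; first by right.
  rewrite /pospart /Num.max !ler_norml.
  by do 2 case: ifPn => //; rewrite -?leNgt; have := enorm_ge0 d; lra.
- rewrite !pospart_eq0// subrr normr0; have := enorm_ge0 d; lra.
Qed.

(** Let t = e^2 - |y|^2, let q = 2 y.d + |d|^2 be the increment of |.|^2 and write
    p for the square of the positive part. By convexity
    0 <= p (t - q) - p t + 2 max (t, 0) q <= q^2, and replacing q by 2 y.d in the
    linear term costs another multiple of |d|^2. *)
Lemma moll_taylor e y d : 0 <= e -> e <= 1 -> enorm d <= 1 ->
  `|moll e (y + d) - moll e y - dot (dmoll e y) d| <= 27 * enorm d ^+ 2.
Proof.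
move=> e0 e1 d1.
have e2 : e ^+ 2 <= 1 by rewrite expr_le1.
have -> : dot (dmoll e y) d = - 4 * pospart e y * dot y d.
  by rewrite dotC dotZr dotC.
have [yde|] := pselect (enorm y < e \/ enorm (y + d) < e); last first.
  move=> /not_orP[/negP + /negP]; rewrite -!leNgt => ye yde.
  rewrite /moll !pospart_eq0//.
  by rewrite expr0n/= mulr0 mul0r !subrr normr0 mulr_ge0// sqr_ge0.
have [_] := pospart_diff e0 e1 d1 yde.
rewrite dotDD /moll /pospart dotDD -sqr_enorm -(sqr_enorm d).
set P := dot y d; set D := enorm d; set Y := enorm y => h.
have D0 : 0 <= D := enorm_ge0 _.
have h2 : (2 * P + D ^+ 2) ^+ 2 <= 25 * D ^+ 2.
  rewrite (_ : 25 * D ^+ 2 = (5 * D) ^+ 2); last ring.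
  rewrite -real_normK ?num_real//.
  rewrite ler_pXn2r// ?nnegrE ?mulr_ge0//.
  by apply: le_trans h; rewrite le_eqVlt; apply/orP; left; apply/eqP; congr `|_|; ring.
have Y0 : 0 <= Y ^+ 2 by exact: sqr_ge0.
have DD : 0 <= D ^+ 2 by exact: sqr_ge0.
set q := 2 * P + D ^+ 2 in h2.
have -> : e ^+ 2 - (Y ^+ 2 + 2 * P + D ^+ 2) = e ^+ 2 - Y ^+ 2 - q.
  by rewrite /q; ring.
have -> : P = (q - D ^+ 2) / 2 by rewrite /q; field.
set a := e ^+ 2 - Y ^+ 2.
have a1 : a <= 1 by rewrite /a; lra.
clearbody a q; clear -h2 a1 DD.
move: (D ^+ 2) h2 DD => {}D h2 DD.
rewrite ler_norml /Num.max.
case: ifPn => [|]; rewrite -?leNgt => h3; (case: ifPn => [|]; rewrite -?leNgt => h4);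
  apply/andP; split; nra.
Qed.

Lemma dmoll_lip e y d i : 0 <= e -> e <= 1 -> enorm d <= 1 ->
  `|dmoll e (y + d) 0 i - dmoll e y 0 i| <= 44 * enorm d.
Proof.
move=> e0 e1 d1; have d0 := enorm_ge0 d.
have [yde|] := pselect (enorm y < e \/ enorm (y + d) < e); last first.
  move=> /not_orP[/negP + /negP]; rewrite -!leNgt => ye yde.
  rewrite /dmoll !pospart_eq0// !mxE mulr0 !mul0r subrr normr0; lra.
have [y2 _] := pospart_diff e0 e1 d1 yde.
have := pospart_lip y e0 e1 d1.
have := coord_le_enorm y i; have := coord_le_enorm d i.
have := pospart_le (y + d) e0 e1; have := pospart_ge0 e (y + d).
rewrite !mxE.
move: (pospart e (y + d)) (pospart e y) (enorm d) (enorm y) (y 0 i) (d 0 i) d1 d0 y2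
  => b a D Y yi di d1 d0 y2 b0 b1 di0 yi0 ab.
rewrite (_ : _ - _ = - 4 * (di * b + yi * (b - a))); last ring.
rewrite normrM normrN normr_nat.
have := ler_normD (di * b) (yi * (b - a)).
rewrite !normrM (ger0_norm b0).
have := normr_ge0 di; have := normr_ge0 yi; have := normr_ge0 (b - a).
nra.
Qed.

Lemma dmoll_le e x i : 0 <= e -> e <= 1 -> `|dmoll e x 0 i| <= 4.
Proof.
move=> e0 e1; rewrite mxE.
have [xe|xe] := leP e (enorm x); first by rewrite pospart_eq0// mulr0 mul0r normr0.
have := coord_le_enorm x i; have := pospart_le x e0 e1; have := pospart_ge0 e x.
move=> a b c; rewrite normrM normrM normrN normr_nat ger0_norm//.
have := normr_ge0 (x 0 i); nra.
Qed.

Lemma dmollN e x : dmoll e (- x) = - dmoll e x.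
Proof. by rewrite /dmoll /pospart dotNr dotC dotNr opprK scalerN. Qed.

End moll.

(** * Integral operators *)

Section integrable_products.
Context d (T : measurableType d) (R : realType).
Variable mu : {measure set T -> \bar R}.
Implicit Types w k : T -> R.

Lemma integrable_mul_bounded w k B : mu.-integrable setT (EFin \o w) ->
    measurable_fun setT k -> (forall z, `|k z| <= B) ->
  mu.-integrable setT (EFin \o (fun z => w z * k z)).
Proof.
move=> wi mk kB.
have : mu.-integrable setT ((EFin \o w) \* (EFin \o k))%E.
  apply: integrableMl => //; exists B; split; first exact: num_real.
  by move=> b Bb z _ /=; rewrite (le_trans (kB z))// ltW.
by [].
Qed.

Lemma Rintegral_mul_le w k B : mu.-integrable setT (EFin \o w) ->
    measurable_fun setT k -> (forall z, `|k z| <= B) ->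
  `|\int[mu]_z (w z * k z)| <= B * \int[mu]_z `|w z|.
Proof.
move=> wi mk kB.
have wki := integrable_mul_bounded wi mk kB.
rewrite (le_trans (le_normr_Rintegral _ wki))//.
have wni : mu.-integrable setT (EFin \o (fun z => `|w z|)) by exact: integrable_norm.
rewrite -RintegralZl//; apply: le_Rintegral => //.
- exact: (integrable_norm wki).
- by move: (integrableZl (measurableT) B wni).
- by move=> z _; rewrite normrM mulrC ler_wpM2r.
Qed.

Lemma Rintegral_sum (I : Type) (s : seq I) (h : I -> T -> R) :
  (forall i, mu.-integrable setT (EFin \o h i)) ->
  \int[mu]_z (\sum_(i <- s) h i z) = \sum_(i <- s) \int[mu]_z h i z.
Proof.
move=> hi; elim: s => [|i s ih].
  under eq_Rintegral do rewrite big_nil.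
  by rewrite Rintegral_cst// mul0r big_nil.
under eq_Rintegral do rewrite big_cons.
rewrite RintegralD// ?ih ?big_cons//.
rewrite (_ : _ \o _ = (fun z => \sum_(i <- s) (h i z)%:E)%E).
  by apply: integrable_sum => // j _; exact: hi.
by apply/funext => z /=; rewrite sumEFin.
Qed.

End integrable_products.

Section integral_operators.
Context d (T : measurableType d) (R : realType).
Variable mu : {sigma_finite_measure set T -> \bar R}.
Implicit Types w u : T -> R.

Lemma ge0_integralZl_real w c : measurable_fun setT w -> (forall z, 0 <= w z) ->
  0 <= c -> (\int[mu]_z (c * w z)%:E = c%:E * \int[mu]_z (w z)%:E)%E.
Proof.
move=> mw w0 c0; under eq_integral do rewrite EFinM.
apply: ge0_integralZl => //; first exact/measurable_EFinP.
by move=> z _; rewrite lee_fin.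
Qed.

(** Tonelli: an operator with nonnegative kernel of constant column mass M has
    L^1 norm at most M. *)
Lemma integral_operator_L1_le (k : T * T -> R) w (M : R) :
    measurable_fun setT k -> (forall p, 0 <= k p) ->
    (forall z, \int[mu]_x (k (x, z))%:E = M%:E)%E ->
    mu.-integrable setT (EFin \o w) ->
    (forall x, mu.-integrable setT (EFin \o (fun z => w z * k (x, z)))) ->
    measurable_fun setT (fun x => \int[mu]_z (w z * k (x, z))) ->
  (\int[mu]_x (`|\int[mu]_z (w z * k (x, z))|%R)%:E <=
   M%:E * \int[mu]_z (`|w z|%R)%:E)%E.
Proof.
move=> mk k0 kM wi ki mI.
have mw : measurable_fun setT w by exact: ((measurable_EFinP _ _).1 (measurable_int mu wi)).
have mnw : measurable_fun setT (fun z => `|w z|) by exact: measurableT_comp.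
have M0 : 0 <= M.
  rewrite -lee_fin -(kM point); apply: integral_ge0 => x _.
  by rewrite lee_fin k0.
have mK : measurable_fun setT (fun p : T * T => (`|w p.2| * k p)%:E).
  apply/measurable_EFinP; apply: measurable_funM => //.
  exact: (measurableT_comp mnw).
have K0 p : (0 <= (`|w p.2| * k p)%:E)%E by rewrite lee_fin mulr_ge0.
have -> : (M%:E * \int[mu]_z (`|w z|%R)%:E =
    \int[mu]_z \int[mu]_x (`|w z| * k (x, z))%:E)%E.
  rewrite -(ge0_integralZl_real mnw)//; apply: eq_integral => z _.
  rewrite ge0_integralZl_real//; last exact: (measurableT_comp mk).
  by rewrite kM -EFinM mulrC.
rewrite -(fubini_tonelli _ mK)//.
apply: ge0_le_integral => //.
- exact/measurable_EFinP/measurableT_comp.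
- exact: (measurable_fun_fubini_tonelli_F _ mK).
- move=> x _; rewrite EFin_normr_Rintegral//.
  apply: (le_trans (le_abse_integral mu measurableT (measurable_int _ (ki x)))).
  rewrite le_eqVlt; apply/orP; left; apply/eqP; apply: eq_integral => y _ /=.
  by rewrite normrM (ger0_norm (k0 _)).
Qed.

(** Fubini: the operators with kernels k (z, y) and k (y, z) are adjoint. *)
Lemma integral_operator_adjoint (k : T * T -> R) u w (B : R) :
    measurable_fun setT k -> (forall p, `|k p| <= B) ->
    mu.-integrable setT (EFin \o u) -> mu.-integrable setT (EFin \o w) ->
  \int[mu]_z (u z * \int[mu]_y (w y * k (z, y))) =
  \int[mu]_y (w y * \int[mu]_z (u z * k (z, y))).
Proof.
move=> mk kB ui wi.
have mw : measurable_fun setT w by exact: ((measurable_EFinP _ _).1 (measurable_int mu wi)).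
have mu' : measurable_fun setT u by exact: ((measurable_EFinP _ _).1 (measurable_int mu ui)).
have kwi z : mu.-integrable setT (EFin \o (fun y => w y * k (z, y))).
  by apply: (@integrable_mul_bounded _ _ _ _ _ _ B) => //; exact: measurableT_comp.
have kui y : mu.-integrable setT (EFin \o (fun z => u z * k (z, y))).
  apply: (@integrable_mul_bounded _ _ _ _ _ _ B) => //.
  exact: (measurableT_comp mk).
pose F (p : T * T) : \bar R := (u p.1 * (w p.2 * k p))%:E.
have mF : measurable_fun setT F.
  apply/measurable_EFinP; apply: measurable_funM.
    exact: (measurableT_comp mu').
  by apply: measurable_funM => //; exact: (measurableT_comp mw).
have maF : measurable_fun setT (abse \o F) by exact: measurableT_comp.
have W0 : 0 <= \int[mu]_y `|w y| by exact: Rintegral_ge0.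
have Fi : (mu \x mu)%E.-integrable setT F.
  apply/(integrable12ltyP mu mu mF).
  pose C := B * \int[mu]_y `|w y|.
  have B0 (z : T) : 0 <= B by exact: le_trans (normr_ge0 _) (kB (z, z)).
  apply: (@le_lt_trans _ _ (\int[mu]_z (C * `|u z|)%:E)%E).
    apply: ge0_le_integral => //.
    - by move=> z _; apply: integral_ge0.
    - exact: (measurable_fun_fubini_tonelli_F _ maF (fun=> abse_ge0 _)).
    - by apply/measurable_EFinP; apply: measurable_funM => //;
        exact: measurableT_comp.
    - move=> z _; rewrite /F/=.
      under eq_integral do rewrite normrM.
      have mwk : measurable_fun setT (fun y => `|w y * k (z, y)|).
        by apply: measurableT_comp => //; apply: measurable_funM => //;
          exact: measurableT_comp.
      rewrite ge0_integralZl_real// mulrC EFinM lee_wpmul2l ?lee_fin//.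
      rewrite /C EFinM /Rintegral fineK; last first.
        exact: (integrable_fin_num measurableT (integrable_norm wi)).
      have mnw : measurable_fun setT (fun y => `|w y|) by exact: measurableT_comp.
      rewrite -ge0_integralZl_real//; last exact: B0.
      apply: ge0_le_integral => //.
      + exact/measurable_EFinP.
      + apply/measurable_EFinP; exact: measurable_funM.
      + by move=> y _; rewrite lee_fin normrM mulrC ler_wpM2r.
  rewrite ge0_integralZl_real//; last 2 first.
  - exact: measurableT_comp.
  - by rewrite mulr_ge0//; exact: B0 point.
  by apply: lte_mul_pinfty; [rewrite lee_fin mulr_ge0//; exact: B0 point|by []|
    move/integrableP : ui => []].
have l z : u z * \int[mu]_y (w y * k (z, y)) = \int[mu]_y (u z * (w y * k (z, y))).
  by rewrite RintegralZl.
have r y : w y * \int[mu]_z (u z * k (z, y)) = \int[mu]_z (u z * (w y * k (z, y))).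
  rewrite -RintegralZl//; apply: eq_Rintegral => z _.
  by rewrite mulrCA.
under eq_Rintegral do rewrite l.
under [RHS]eq_Rintegral do rewrite r.
have := Fubini Fi; rewrite /F/= => FF.
rewrite /Rintegral; congr fine.
transitivity (\int[mu]_x \int[mu]_y (u x * (w y * k (x, y)))%:E)%E.
  apply: eq_integral => z _; rewrite fineK//.
  by apply: integrable_fin_num => //; move: (integrableZl measurableT (u z) (kwi z)).
rewrite FF; apply: eq_integral => y _; rewrite fineK//.
apply: integrable_fin_num => //.
have := integrableZl measurableT (w y) (kui y).
by apply: eq_integrable => // z _ /=; rewrite -EFinM mulrCA.
Qed.

End integral_operators.

Section measurable_moll.
Context d (T : measurableType d) (R : realType) (N : nat).
Variable f : T -> 'rV[R]_N.+1.
Hypothesis mf : forall i, measurable_fun setT (fun t => f t 0 i).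

Lemma measurable_dot_self : measurable_fun setT (fun t => dot (f t) (f t)).
Proof.
by apply: measurable_sum => i; apply: measurable_funM; exact: mf.
Qed.

Lemma measurable_enorm : measurable_fun setT (fun t => enorm (f t)).
Proof.
under eq_fun do rewrite enormE.
apply: (measurableT_comp _ measurable_dot_self).
apply: continuous_measurable_fun; exact: sqrt_continuous.
Qed.

Lemma measurable_pospart e : measurable_fun setT (fun t => pospart e (f t)).
Proof.
apply: measurable_maxr; last exact: measurable_cst.
by apply: measurable_funB; [exact: measurable_cst|exact: measurable_dot_self].
Qed.

Lemma measurable_moll e : measurable_fun setT (fun t => moll e (f t)).
Proof. exact/measurable_funX/measurable_pospart. Qed.

Lemma measurable_dmoll e i : measurable_fun setT (fun t => dmoll e (f t) 0 i).
Proof.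
under eq_fun do rewrite mxE.
apply: measurable_funM; last exact: mf.
by apply: measurable_funM; [exact: measurable_cst|exact: measurable_pospart].
Qed.

End measurable_moll.

(** * Mollification *)

Section convolution.
Context (R : realType) (N : nat).
Local Notation V := 'rV[R]_N.+1.
Local Notation L := (lebesgue_rV R N).
Local Notation mu := (@lebesgue R N : {measure set L -> \bar R}).
Variables (e : R) (e0 : 0 <= e) (e1 : e <= 1).

Definition mollify (w : V -> R) (x : V) : R := \int[mu]_z (w z * moll e (x - z)).

Definition dmollify (w : V -> R) (x : V) : V :=
  \row_i \int[mu]_z (w z * dmoll e (x - z) 0 i).

Lemma measurable_coordB (x : V) i :
  measurable_fun setT (fun z : L => (x - (z : V)) 0 i).
Proof.
rewrite (_ : (fun _ => _) = (fun z : L => x 0 i - (z : V) 0 i)).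
  by apply: measurable_funB; [exact: measurable_cst|exact: measurable_coord].
by apply/funext => z; rewrite !mxE.
Qed.

Variables (w : V -> R).
Hypothesis wi : mu.-integrable setT (EFin \o w : L -> \bar R).

Let mollB x : measurable_fun setT (fun z : L => moll e (x - (z : V))).
Proof. by apply: measurable_moll => i; exact: measurable_coordB. Qed.

Let dmollB x i : measurable_fun setT (fun z : L => dmoll e (x - (z : V)) 0 i).
Proof. by apply: measurable_dmoll => j; exact: measurable_coordB. Qed.

Lemma mollify_integrand x :
  mu.-integrable setT (EFin \o (fun z : L => w z * moll e (x - (z : V)))).
Proof.
apply: (@integrable_mul_bounded _ _ _ _ _ _ 1) => // z.
by rewrite ger0_norm ?moll_ge0 ?moll_le1.
Qed.

Lemma dmollify_integrand x i :
  mu.-integrable setT (EFin \o (fun z : L => w z * dmoll e (x - (z : V)) 0 i)).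
Proof.
by apply: (@integrable_mul_bounded _ _ _ _ _ _ 4) => // z; exact: dmoll_le.
Qed.

(** Inherited from the kernel by linearity of the integral in the kernel, so that
    nothing is differentiated under the integral sign. *)
Lemma mollify_taylor x h : enorm h <= 1 ->
  `|mollify w (x + h) - mollify w x - dot (dmollify w x) h| <=
  27 * enorm h ^+ 2 * \int[mu]_z `|w z|.
Proof.
move=> h1.
have ih i : mu.-integrable setT
    (EFin \o (fun z : L => w z * dmoll e (x - (z : V)) 0 i * h 0 i)).
  apply: (@integrable_mul_bounded _ _ _ _ _ _ `|h 0 i|) => //.
  exact: dmollify_integrand.
have -> : dot (dmollify w x) h =
    \int[mu]_z (w z * dot (dmoll e (x - z)) h).
  rewrite /dot; under eq_Rintegral do rewrite mulr_sumr.
  transitivity (\sum_i \int[mu]_z (w z * dmoll e (x - z) 0 i * h 0 i)).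
    by apply: eq_bigr => i _; rewrite mxE RintegralZr//; exact: dmollify_integrand.
  rewrite -Rintegral_sum//; apply: eq_Rintegral => z _.
  by apply: eq_bigr => i _; rewrite mulrA.
have mdot : measurable_fun setT (fun z : L => dot (dmoll e (x - (z : V))) h).
  by apply: measurable_sum => i; apply: measurable_funM => //; exact: measurable_cst.
have idot : mu.-integrable setT
    (EFin \o (fun z : L => w z * dot (dmoll e (x - (z : V))) h)).
  apply: (@integrable_mul_bounded _ _ _ _ _ _ (4 * \sum_i `|h 0 i|)) => //.
  move=> z; rewrite mulr_sumr (le_trans (ler_norm_sum _ _ _))//.
  by apply: ler_sum => i _; rewrite normrM ler_wpM2r// dmoll_le.
rewrite /mollify -RintegralB//; try exact: mollify_integrand.
rewrite -RintegralB//; last first.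
  exact: (integrableB measurableT (mollify_integrand _) (mollify_integrand _)).
rewrite (_ : (fun z => _ - _) = fun z => w z * (moll e (x - z + h) -
    moll e (x - z) - dot (dmoll e (x - z)) h)); last first.
  by apply/funext => z; rewrite (addrAC x h) !mulrBr.
apply: Rintegral_mul_le; [exact: wi| |by move=> z; exact: moll_taylor].
have mh : measurable_fun setT (fun z : L => moll e (x - (z : V) + h)).
  rewrite (_ : (fun _ => _) = (fun z : L => moll e (x + h - (z : V)))).
    exact: mollB.
  by apply/funext => z; rewrite addrAC.
exact: (measurable_funB (measurable_funB mh (mollB x)) mdot).
Qed.

Lemma dmollify_lip x h i : enorm h <= 1 ->
  `|dmollify w (x + h) 0 i - dmollify w x 0 i| <= 44 * enorm h * \int[mu]_z `|w z|.
Proof.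
move=> h1; rewrite !mxE -RintegralB//; try exact: dmollify_integrand.
rewrite (_ : (fun z => _ - _) = fun z => w z * (dmoll e (x - z + h) 0 i -
    dmoll e (x - z) 0 i)); last first.
  by apply/funext => z; rewrite (addrAC x h) mulrBr.
apply: Rintegral_mul_le; [exact: wi| |by move=> z; exact: dmoll_lip].
have mh : measurable_fun setT (fun z : L => dmoll e (x - (z : V) + h) 0 i).
  rewrite (_ : (fun _ => _) = (fun z : L => dmoll e (x + h - (z : V)) 0 i)).
    exact: dmollB.
  by apply/funext => z; rewrite addrAC.
exact: (measurable_funB mh (dmollB x i)).
Qed.

End convolution.

Lemma integrable_indic_lty d (T : measurableType d) (R : realType)
    (mu : {measure set T -> \bar R}) (A : set T) :
  measurable A -> (mu A < +oo)%E -> mu.-integrable setT (EFin \o \1_A).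
Proof.
move=> mA Aoo; apply/integrableP; split.
  exact/measurable_EFinP/measurable_indic.
under eq_integral do rewrite /= ger0_norm ?ler0n//.
by rewrite integral_indic// setIT.
Qed.

Section local_lipschitz.
Context (R : realType) (N : nat) (W : normedModType R).
Local Notation V := 'rV[R]_N.+1.

Lemma enorm_le_norm (x : V) : enorm x <= N.+1%:R * `|x|.
Proof.
apply: le_trans (enorm_le_sum x) _.
rewrite mulr_natl -[X in _ *+ X](card_ord N.+1) -sumr_const.
by apply: ler_sum => i _; exact: rV_coord_le_norm.
Qed.

Lemma norm_le_enorm (x : V) : `|x| <= enorm x.
Proof.
by apply: rV_norm_le => [|i]; [exact: enorm_ge0|exact: coord_le_enorm].
Qed.

(** Translates estimates in the Euclidean norm into continuity for the topology,
    which comes from the maximum norm. *)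
Lemma lipschitz_at_continuous (f : V -> W) (x : V) (K : R) :
  (forall h, enorm h <= 1 -> `|f (x + h) - f x| <= K * enorm h) ->
  {for x, continuous f}.
Proof.
move=> fK; have Fx : Filter (nbhs x) := nbhs_filter x.
apply/cvgrPdist_lt => r r0.
pose K1 := `|K| + 1; have K10 : 0 < K1 by rewrite ltr_wpDl.
pose s := Num.min 1 (r / K1) / N.+1%:R.
have s0 : 0 < s by rewrite divr_gt0// lt_min ltr01 divr_gt0.
apply: (filterS _ (nbhsx_ballx x s s0)) => y; rewrite -ball_normE/= => xy.
have yx : enorm (y - x) < Num.min 1 (r / K1).
  apply: le_lt_trans (enorm_le_norm _) _.
  by rewrite mulrC -ltr_pdivlMr// distrC.
move: yx; rewrite lt_min => /andP[y1 yr].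
have := fK _ (ltW y1); rewrite (addrC x) subrK distrC => /le_lt_trans; apply.
have : K * enorm (y - x) <= K1 * enorm (y - x).
  rewrite ler_wpM2r ?enorm_ge0// /K1 (le_trans (ler_norm K))// lerDl//.
by move=> /le_lt_trans; apply; rewrite mulrC -ltr_pdivlMr.
Qed.

End local_lipschitz.

Section convolution_continuity.
Context (R : realType) (N : nat).
Local Notation V := 'rV[R]_N.+1.
Local Notation L := (lebesgue_rV R N).
Local Notation mu := (@lebesgue R N : {measure set L -> \bar R}).
Variables (e : R) (e0 : 0 <= e) (e1 : e <= 1).
Variables (w : V -> R).
Hypothesis wi : mu.-integrable setT (EFin \o w : L -> \bar R).

Lemma mollify_continuous : continuous (mollify e w).
Proof.
move=> x; apply: (@lipschitz_at_continuous _ _ _ _ _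
  (enorm (dmollify e w x) + 27 * \int[mu]_z `|w z|)) => h h1.
have W0 : 0 <= \int[mu]_z `|w z| by exact: Rintegral_ge0.
have := mollify_taylor e0 e1 wi x h1; have := dot_norm_le (dmollify e w x) h.
have := ler_normD (mollify e w (x + h) - mollify e w x - dot (dmollify e w x) h)
  (dot (dmollify e w x) h); rewrite subrK.
have := enorm_ge0 h.
move: (\int[mu]_z `|w z|) W0 => A A0 h0 a b c.
have : enorm h ^+ 2 <= enorm h by rewrite expr2 ler_piMl.
nra.
Qed.

Lemma dmollify_coord_continuous i : continuous (fun x => dmollify e w x 0 i).
Proof.
move=> x; apply: (@lipschitz_at_continuous _ _ _ _ _
  (44 * \int[mu]_z `|w z|)) => h h1.
by rewrite mulrAC; exact: dmollify_lip.
Qed.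

End convolution_continuity.

Section mollifier_mass.
Context (R : realType) (N : nat).
Local Notation V := 'rV[R]_N.+1.
Local Notation L := (lebesgue_rV R N).
Local Notation mu := (@lebesgue R N : {measure set L -> \bar R}).

Lemma measurable_coord_id i : measurable_fun setT (fun z : L => (z : V) 0 i).
Proof. exact: measurable_coord. Qed.

Lemma integrable_bounded_support (f : V -> R) (B r : R) :
    measurable_fun setT (f : L -> R) ->
    (forall x, `|f x| <= B) -> (forall x, r <= enorm x -> f x = 0) ->
  mu.-integrable setT (EFin \o f : L -> \bar R).
Proof.
move=> mf fB f0.
have mc : measurable (cube r : set L) by exact: measurable_box.
have ic : mu.-integrable setT (fun x : L => (B%:E * (\1_(cube r : set V) x)%:E)%E).
  by apply: integrableZl => //; apply: integrable_indic_lty => //;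
    exact: lebesgue_box_lty.
apply: (le_integrable measurableT _ _ ic); first exact/measurable_EFinP.
move=> x _ /=; rewrite indicE lee_fin normrM.
have B0 : 0 <= B by exact: le_trans (normr_ge0 _) (fB x).
have [rx|rx] := leP r (enorm x).
  by rewrite f0// normr0 mulr_ge0.
rewrite mem_set; first by rewrite normr1 mulr1 (ger0_norm B0).
apply: cube_norm; apply: le_lt_trans rx.
by apply: rV_norm_le => [|i]; [exact: enorm_ge0|exact: coord_le_enorm].
Qed.

(** The kernel is not normalised: dividing by its mass is postponed to the end. *)
Definition mass (e : R) : R := \int[mu]_x moll e (x : V).

Variables (e : R) (e0 : 0 <= e) (e1 : e <= 1).

Let mmoll : measurable_fun setT (fun z : L => moll e (z : V)).
Proof. by apply: measurable_moll => i; exact: measurable_coord. Qed.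

Lemma moll_integrable : mu.-integrable setT (EFin \o moll e : L -> \bar R).
Proof.
apply: (@integrable_bounded_support _ 1 e) => [//|x|x xe].
  by rewrite ger0_norm ?moll_ge0 ?moll_le1.
by rewrite moll_eq0.
Qed.

Lemma mass_ge0 : 0 <= mass e.
Proof. by apply: Rintegral_ge0 => x _; exact: moll_ge0. Qed.

Lemma EFin_mass : (mass e)%:E = (\int[mu]_x (moll e (x : V))%:E)%E.
Proof.
rewrite /mass /Rintegral fineK//.
exact: (integrable_fin_num measurableT moll_integrable).
Qed.

Lemma integral_mollB (y : V) :
  (\int[mu]_x (moll e ((x : V) - y))%:E = (mass e)%:E)%E.
Proof.
rewrite EFin_mass.
apply: (@ge0_integral_shift R N (- y) (fun x => (moll e x)%:E)).
  exact/measurable_EFinP.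
by move=> x; rewrite lee_fin moll_ge0.
Qed.

Lemma integral_mollBr (x : V) :
  (\int[mu]_y (moll e (x - (y : V)))%:E = (mass e)%:E)%E.
Proof.
rewrite -(integral_mollB x); apply: eq_integral => y _.
by rewrite -mollN opprB.
Qed.

Lemma Rintegral_mollBr (x : V) : \int[mu]_y moll e (x - (y : V)) = mass e.
Proof. by rewrite /Rintegral integral_mollBr. Qed.

Lemma mollBr_integrable (x : V) :
  mu.-integrable setT (EFin \o (fun y : L => moll e (x - (y : V)))).
Proof.
apply/integrableP; split.
  by apply/measurable_EFinP; apply: measurable_moll => i; exact: measurable_coordB.
under eq_integral do rewrite /= ger0_norm ?moll_ge0//.
by rewrite integral_mollBr ltry.
Qed.

Lemma measurable_coordB2 i :
  measurable_fun setT (fun p : L * L => ((p.1 : V) - (p.2 : V)) 0 i).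
Proof.
rewrite (_ : (fun _ => _) = (fun p : L * L => (p.1 : V) 0 i - (p.2 : V) 0 i)).
  apply: measurable_funB.
    exact: (measurableT_comp (measurable_coord_id i) measurable_fst).
  exact: (measurableT_comp (measurable_coord_id i) measurable_snd).
by apply/funext => z; rewrite !mxE.
Qed.

Variables (w : V -> R).
Hypothesis wi : mu.-integrable setT (EFin \o w : L -> \bar R).

Let mw : measurable_fun setT (w : L -> R).
Proof. exact/measurable_EFinP/(measurable_int _ wi). Qed.

Lemma integral_mollify_le :
  (\int[mu]_x (`|mollify e w x|%R)%:E <=
   (mass e)%:E * \int[mu]_z (`|w z|%R)%:E)%E.
Proof.
pose k (p : L * L) := moll e ((p.1 : V) - (p.2 : V)).
have mk : measurable_fun setT k.
  by apply: measurable_moll => i; exact: measurable_coordB2.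
apply: (@integral_operator_L1_le _ L R mu k w (mass e) mk).
- by move=> p; exact: moll_ge0.
- exact: integral_mollB.
- exact: wi.
- by move=> x; exact: mollify_integrand.
- exact: (measurable_continuous (mollify_continuous e0 e1 wi)).
Qed.

End mollifier_mass.

Section mollification_adjoint.
Context (R : realType) (N : nat).
Local Notation V := 'rV[R]_N.+1.
Local Notation L := (lebesgue_rV R N).
Local Notation mu := (@lebesgue R N : {measure set L -> \bar R}).

(** The sign comes from dmoll being odd. Summed over i for a vector field w, this
    is the integration by parts formula behind mollify_gradient_le. *)
Lemma dmollify_adjoint (e : R) (u w : V -> R) i : 0 <= e -> e <= 1 ->
    mu.-integrable setT (EFin \o u : L -> \bar R) ->
    mu.-integrable setT (EFin \o w : L -> \bar R) ->
  \int[mu]_z (u z * dmollify e w z 0 i) = - \int[mu]_y (w y * dmollify e u y 0 i).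
Proof.
move=> e0 e1 ui wi.
pose k (p : L * L) := dmoll e ((p.1 : V) - (p.2 : V)) 0 i.
have mk : measurable_fun setT k.
  by apply: measurable_dmoll => j; exact: measurable_coordB2.
have kB p : `|k p| <= 4 by exact: dmoll_le.
transitivity (\int[mu]_z (u z * \int[mu]_y (w y * k (z, y)))).
  by apply: eq_Rintegral => z _; rewrite mxE.
rewrite (integral_operator_adjoint mk kB ui wi).
have im (y : V) : mu.-integrable setT
    (EFin \o (fun z : L => u z * dmoll e (y - (z : V)) 0 i)).
  exact: dmollify_integrand.
rewrite -mulN1r -RintegralZl; last 2 first.
- exact: measurableT.
- apply: (@integrable_mul_bounded _ _ _ _ _ _ (4 * \int[mu]_z `|u z|)).
  + exact: wi.
  + exact: (measurable_continuous (@dmollify_coord_continuous _ _ e e0 e1 u ui i)).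
  + move=> y; rewrite mxE; apply: Rintegral_mul_le; first exact: ui.
      by apply: measurable_dmoll => j; exact: measurable_coordB.
    by move=> z; exact: dmoll_le.
apply: eq_Rintegral => y _; rewrite mulN1r -mulrN; congr (_ * _).
rewrite mxE -mulN1r -RintegralZl; [|exact: measurableT|exact: im].
apply: eq_Rintegral => z _.
by rewrite /k/= -opprB dmollN mxE mulN1r mulrN.
Qed.

End mollification_adjoint.

(** * Mollified vector fields as test fields *)

Section mollified_fields.
Context (R : realType) (N : nat).
Local Notation V := 'rV[R]_N.+1.
Local Notation L := (lebesgue_rV R N).
Local Notation mu := (@lebesgue R N : {measure set L -> \bar R}).
Variables (e : R) (e0 : 0 < e) (e1 : e <= 1).

Let e0' : 0 <= e. Proof. exact: ltW. Qed.

Lemma mollify_derive_cvg (w : V -> R) (x v : V) :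
  mu.-integrable setT (EFin \o w : L -> \bar R) ->
  h^-1 *: ((mollify e w \o shift x) (h *: v) - mollify e w x) @[h --> 0^']
    --> dot (dmollify e w x) v.
Proof.
move=> wi; apply/cvgrPdist_le => r r0.
pose K := 1 + 27 * enorm v ^+ 2 * \int[mu]_z `|w z| + enorm v.
have W0 : 0 <= \int[mu]_z `|w z| by exact: Rintegral_ge0.
have K2 : 0 <= 27 * enorm v ^+ 2 * \int[mu]_z `|w z|.
  by rewrite mulr_ge0// mulr_ge0// sqr_ge0.
have v0 := enorm_ge0 v.
have K0 : 0 < K by rewrite ltr_wpDr// ltr_wpDr.
near=> h.
have h0 : h != 0 by near: h; exact: nbhs_dnbhs_neq.
have hK : `|h| <= Num.min r 1 / K.
  near: h; apply: dnbhs0_le.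
  by rewrite divr_gt0// lt_min r0 ltr01.
move: hK; rewrite ler_pdivlMr// le_min => /andP[hr h1].
have hv : enorm (h *: v) <= 1.
  by rewrite enormZ (le_trans _ h1)// ler_wpM2l// lerDr addr_ge0.
have := mollify_taylor e0' e1 wi x hv.
rewrite /= (addrC _ x) dotZr enormZ exprMn real_normK ?num_real// => ht.
rewrite distrC.
have -> : h^-1 *: (mollify e w (x + h *: v) - mollify e w x) - dot (dmollify e w x) v =
  h^-1 * (mollify e w (x + h *: v) - mollify e w x - h * dot (dmollify e w x) v).
  by rewrite mulrBr mulKf.
rewrite normrM normfV ler_pdivrMl ?normr_gt0//.
apply: le_trans ht _.
rewrite -(real_normK (num_real h)) expr2.
have h00 := normr_ge0 h.
rewrite mulrA (mulrC 27) -!mulrA ler_wpM2l//.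
apply: le_trans hr; rewrite ler_wpM2l//.
rewrite (_ : 27 * _ = 27 * enorm v ^+ 2 * \int[mu]_z `|w z|).
  by rewrite /K (addrC 1) -addrA lerDl addr_ge0.
by rewrite expr2 !mulrA.
Unshelve. all: by end_near. Qed.

Lemma mollify_derivable (w : V -> R) (x v : V) :
  mu.-integrable setT (EFin \o w : L -> \bar R) -> derivable (mollify e w) x v.
Proof. by move=> wi; apply: cvgP; exact: mollify_derive_cvg. Qed.

Lemma mollify_derive (w : V -> R) (x v : V) :
  mu.-integrable setT (EFin \o w : L -> \bar R) ->
  'D_v (mollify e w) x = dot (dmollify e w x) v.
Proof. by move=> wi; apply/cvg_lim => //; exact: mollify_derive_cvg. Qed.

Lemma dot_delta (x : V) i : dot x (delta_mx 0 i) = x 0 i.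
Proof.
rewrite /dot (bigD1 i)//= mxE !eqxx mulr1 big1 ?addr0// => j ji.
by rewrite mxE (negbTE ji) andbF mulr0.
Qed.

Variable w : 'I_N.+1 -> V -> R.
Hypothesis wi : forall i, mu.-integrable setT (EFin \o w i : L -> \bar R).

Definition mollify_field (z : V) : V := \row_i mollify e (w i) z.

Lemma mollify_field_coord i :
  (fun z => mollify_field z 0 i) = mollify e (w i).
Proof. by apply/funext => z; rewrite mxE. Qed.

Lemma mollify_field_derivable x i : derivable mollify_field x (delta_mx 0 i).
Proof.
apply/derivable_mxP => i0 j; rewrite ord1 mollify_field_coord.
exact: mollify_derivable.
Qed.

Lemma mollify_field_derive x i :
  'D_(delta_mx 0 i) mollify_field x = \row_j dmollify e (w j) x 0 i.
Proof.
rewrite derive_mx; last exact: mollify_field_derivable.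
apply/rowP => j; rewrite !mxE mollify_field_coord mollify_derive//.
by rewrite dot_delta mxE.
Qed.

Lemma divergence_mollify_field x :
  divergence mollify_field x = \sum_i dmollify e (w i) x 0 i.
Proof. by apply: eq_bigr => i _; rewrite mollify_field_derive mxE. Qed.

Lemma mollify_field_derive_continuous i :
  continuous ('D_(delta_mx 0 i) mollify_field).
Proof.
move=> x; apply: (@lipschitz_at_continuous _ _ _ _ _
  (\sum_j 44 * \int[mu]_z `|w j z|)) => h h1.
have s0 j : 0 <= 44 * \int[mu]_z `|w j z|.
  by rewrite mulr_ge0//; exact: Rintegral_ge0.
rewrite !mollify_field_derive; apply: rV_norm_le => [|j].
  by rewrite mulr_ge0 ?enorm_ge0// sumr_ge0.
rewrite mxE [X in _ + X]mxE [X in `|X - _|]mxE [X in `|_ - X|]mxE.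
have := dmollify_lip e0' e1 (wi j) x i h1 => /le_trans; apply.
rewrite mulrAC ler_wpM2r ?enorm_ge0//.
by rewrite (bigD1 j)//= lerDl sumr_ge0.
Qed.

Variable A : set V.
Hypothesis wA : forall i y, ~ A y -> w i y = 0.

(** Mollification enlarges supports by at most e. *)
Lemma mollify_field_support z : mollify_field z != 0 ->
  exists2 y, A y & enorm (z - y) < e.
Proof.
apply: contra_neqP => /forall2NP noy; apply/rowP => i; rewrite !mxE.
transitivity (\int[mu]_y (0 : R)); last by rewrite Rintegral_cst// mul0r.
apply: eq_Rintegral => y _; have [/wA ->|/negP] := noy y; first by rewrite mul0r.
by rewrite -leNgt => ey; rewrite moll_eq0// mulr0.
Qed.

Lemma mollify_field_C1c (Omega : set V) r :
    (forall y, A y -> `|y| <= r) ->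
    (forall y z, A y -> `|z - y| < 2 * e -> Omega z) ->
  C1c_field Omega mollify_field.
Proof.
move=> Ar AO.
have cl z : closure [set x | mollify_field x != 0] z ->
    exists2 y, A y & `|z - y| < 2 * e.
  move=> /(_ _ (nbhsx_ballx z e e0))[x [/= /mollify_field_support[y Ay xy]]].
  rewrite -ball_normE/= => zx; exists y => //.
  rewrite -(subrKA x) (le_lt_trans (ler_normD _ _))// mulr_natl mulr2n ltrD//.
  exact: le_lt_trans (norm_le_enorm _) xy.
split.
- by move=> i x; exact: mollify_field_derivable.
- exact: mollify_field_derive_continuous.
- apply: bounded_closed_compact; last exact: closed_closure.
  exists (r + 2 * e); split; first exact: num_real.
  move=> b rb z /cl[y Ay zy] /=; rewrite ltW// (le_lt_trans _ rb)//.
  rewrite -(subrK y z) addrC (le_trans (ler_normD _ _))// lerD// ?Ar//.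
  exact: ltW.
- by move=> z /cl[y Ay zy]; exact: AO Ay zy.
Qed.

(** Tested against a unit vector, the field is an average of numbers bounded by
    k, weighted by a kernel of mass mass N e. *)
Lemma mollify_field_le1 k : 0 <= k -> k * mass N e <= 1 ->
  (forall y, enorm (\row_i w i y) <= k) -> forall z, enorm (mollify_field z) <= 1.
Proof.
move=> k0 km wk z; apply: enorm_le_dot => // v v1.
have vi i : mu.-integrable setT
    (EFin \o (fun y : L => v 0 i * (w i y * moll e (z - (y : V))))).
  by move: (integrableZl measurableT (v 0 i) (mollify_integrand e0' e1 (wi i) z)).
have -> : dot v (mollify_field z) =
    \int[mu]_y (\sum_i v 0 i * (w i y * moll e (z - y))).
  rewrite Rintegral_sum; last exact: vi.
  apply: eq_bigr => i _; rewrite mxE RintegralZl; [by []|exact: measurableT|].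
  exact: mollify_integrand.
have ki : mu.-integrable setT (EFin \o (fun y : L => k * moll e (z - (y : V)))).
  by move: (integrableZl measurableT k (mollBr_integrable e0' e1 z)).
apply: (@le_trans _ _ (\int[mu]_y (k * moll e (z - y)))).
  apply: le_Rintegral; [exact: measurableT| |exact: ki|].
  - rewrite (_ : _ \o _ =
      (fun y => \sum_i (v 0 i * (w i y * moll e (z - y)))%:E)%E); last first.
      by apply/funext => y /=; rewrite sumEFin.
    by apply: integrable_sum => // i _; exact: vi.
  - move=> y _; under eq_bigr do rewrite mulrA.
    rewrite -mulr_suml ler_wpM2r ?moll_ge0//.
    have -> : \sum_i v 0 i * w i y = dot v (\row_i w i y).
      by apply: eq_bigr => i _; rewrite mxE.
    rewrite (le_trans (dot_le _ _))//.
    by rewrite (le_trans _ (wk y))// ler_piMl ?enorm_ge0.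
rewrite RintegralZl; [|exact: measurableT|exact: mollBr_integrable].
by rewrite Rintegral_mollBr.
Qed.

End mollified_fields.

(** * The gradient of a mollified function of bounded variation *)

Section mollified_variation.
Context (R : realType) (N : nat).
Local Notation V := 'rV[R]_N.+1.
Local Notation L := (lebesgue_rV R N).
Local Notation mu := (@lebesgue R N : {measure set L -> \bar R}).

Lemma integrable_extension (Omega : set V) (u : V -> R) : open Omega ->
  mu.-integrable (Omega : set L) (EFin \o u) ->
  mu.-integrable setT (EFin \o (u \_ Omega) : L -> \bar R).
Proof.
move=> oO ui; rewrite -restrict_EFin.
exact: (integrable_mkcond (T := L) (EFin \o u) (measurable_open oO)).1.
Qed.

Variables (Omega : set V) (u : V -> R) (A : set V) (e r : R).
Hypothesis oO : open Omega.
Hypothesis ui : mu.-integrable (Omega : set L) (EFin \o u).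
Hypothesis mA : measurable (A : set L).
Hypothesis Ar : forall y, A y -> `|y| <= r.
Hypothesis AO : forall y z, A y -> `|z - y| < 2 * e -> Omega z.
Hypotheses (e0 : 0 < e) (e1 : e <= 1) (k0 : 0 < mass N e).

Let uu := u \_ Omega.
Let e0' : 0 <= e. Proof. exact: ltW. Qed.
Let uui : mu.-integrable setT (EFin \o uu : L -> \bar R).
Proof. exact: integrable_extension. Qed.

Let g := dmollify e uu.
Let n y := enorm (g y).
Let k := (mass N e)^-1.
(* since the inverse of 0 is 0, w vanishes where g does *)
Let w i (y : V) : R := - k * (\1_A y * ((n y)^-1 * g y 0 i)).

Let mg i : measurable_fun setT (fun y : L => g y 0 i).
Proof. exact: (measurable_continuous (dmollify_coord_continuous e0' e1 uui (i:=i))). Qed.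

Let mn : measurable_fun setT (n : L -> R).
Proof. exact: measurable_enorm. Qed.

Let mw i : measurable_fun setT (w i : L -> R).
Proof.
have mni : measurable_fun setT (fun y : L => (n y)^-1).
  rewrite (_ : (fun _ => _) = (fun y : L => n y `^ (- 1))).
    exact: (measurableT_comp (measurable_powR _) mn).
  by apply/funext => y; rewrite powR_inv1// enorm_ge0.
apply: measurable_funM; first exact: measurable_cst.
apply: measurable_funM; first exact: (@measurable_indic _ L R setT A mA).
by apply: measurable_funM; [exact: mni|exact: mg].
Qed.

Let w_le y : enorm (\row_i w i y) <= k.
Proof.
have k0' : 0 <= k by rewrite invr_ge0 ltW.
rewrite (_ : (\row_i _) = (- k * \1_A y * (n y)^-1) *: g y); last first.
  by apply/rowP => i; rewrite [LHS]mxE [RHS]mxE /w !mulrA.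
rewrite enormZ -/(n y) !normrM normrN (ger0_norm k0') normfV.
rewrite (ger0_norm (enorm_ge0 (g y))) -/(n y) -!mulrA ler_piMr//.
rewrite ger0_norm ?indicE// ?ler0n//.
have [n0|n0] := eqVneq (n y) 0; first by rewrite n0 mulr0 mulr0.
by rewrite mulVf// mulr1 lern1 leq_b1.
Qed.

Let w_supp i y : ~ A y -> w i y = 0.
Proof. by move=> Ay; rewrite /w indicE memNset// mul0r mulr0. Qed.

Let wi i : mu.-integrable setT (EFin \o w i : L -> \bar R).
Proof.
apply: (@integrable_bounded_support _ _ _ k (N.+1%:R * r + 1)); first exact: mw.
- move=> y; apply: le_trans (w_le y).
  by apply: le_trans (coord_le_enorm _ i); rewrite mxE.
- move=> y ry; apply: w_supp => /Ar yr.
  have := enorm_le_norm y; rewrite leNgt => /negP; apply.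
  by apply: lt_le_trans ry; rewrite ltr_pwDr// ler_wpM2l.
Qed.

Let wgi i : mu.-integrable setT (EFin \o (fun y : L => w i y * g y 0 i)).
Proof.
apply: (@integrable_mul_bounded _ _ _ _ _ _ (4 * \int[mu]_z `|uu z|)).
- exact: wi.
- exact: mg.
- move=> y; rewrite mxE; apply: Rintegral_mul_le; first exact: uui.
    by apply: measurable_dmoll => j; exact: measurable_coordB.
  by move=> z; exact: dmoll_le.
Qed.

Let udwi i : mu.-integrable setT
  (EFin \o (fun y : L => uu y * dmollify e (w i) y 0 i)).
Proof.
apply: (@integrable_mul_bounded _ _ _ _ _ _ (4 * \int[mu]_z `|w i z|)).
- exact: uui.
- exact: (measurable_continuous (dmollify_coord_continuous e0' e1 (wi i) (i:=i))).
- move=> y; rewrite mxE; apply: Rintegral_mul_le; first exact: wi.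
    by apply: measurable_dmoll => j; exact: measurable_coordB.
  by move=> z; exact: dmoll_le.
Qed.

(** The variation of u does not increase under mollification. The test field is
    the mollification of w = - g / (mass * |g|) on A, where g is the mollified
    gradient: testing u against its divergence gives, by dmollify_adjoint, the
    integral of - w . g, that is of |g| / mass over A. *)
Lemma mollify_gradient_le :
  (\int[mu]_(y in (A : set L)) (enorm (dmollify e (u \_ Omega) y))%:E <=
   (mass N e)%:E * Defs.total_variation Omega u)%E.
Proof.
have nE y : n y * \1_A y = - mass N e * \sum_i w i y * g y 0 i.
  rewrite /w; under eq_bigr do rewrite -!mulrA.
  rewrite -mulr_sumr mulrA mulrNN mulfV ?gt_eqF// mul1r -mulr_sumr mulrC.
  congr (_ * _); rewrite -mulr_sumr.
  have -> : \sum_i g y 0 i * g y 0 i = n y ^+ 2 by rewrite sqr_enorm.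
  have [n0|n0] := eqVneq (n y) 0; first by rewrite n0 invr0 mul0r.
  by rewrite expr2 mulKf.
have si : mu.-integrable setT
    (EFin \o (fun y : L => \sum_i w i y * g y 0 i)).
  rewrite (_ : _ \o _ = (fun y => \sum_i (w i y * g y 0 i)%:E)%E).
    by apply: integrable_sum => // i _; exact: wgi.
  by apply/funext => y /=; rewrite sumEFin.
have usi : mu.-integrable setT
    (EFin \o (fun y : L => \sum_i uu y * dmollify e (w i) y 0 i)).
  rewrite (_ : _ \o _ = (fun y => \sum_i (uu y * dmollify e (w i) y 0 i)%:E)%E).
    by apply: integrable_sum => // i _; exact: udwi.
  by apply/funext => y /=; rewrite sumEFin.
have -> : (\int[mu]_(y in (A : set L)) (enorm (dmollify e (u \_ Omega) y))%:E =
    (mass N e * \int[mu]_y (\sum_i uu y * dmollify e (w i) y 0 i))%:E)%E.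
  rewrite integral_mkcond.
  transitivity (\int[mu]_y (- mass N e * \sum_i w i y * g y 0 i)%:E)%E.
    apply: eq_integral => y _; rewrite -nE patchE indicE.
    by case: ifPn => _; rewrite ?mulr1 ?mulr0.
  transitivity ((\int[mu]_y (- mass N e * \sum_i w i y * g y 0 i))%:E)%E.
    rewrite /Rintegral fineK//; apply: (integrable_fin_num measurableT).
    by move: (integrableZl measurableT (- mass N e) si).
  congr (_%:E); rewrite RintegralZl; [|exact: measurableT|exact: si].
  rewrite Rintegral_sum; last exact: wgi.
  rewrite Rintegral_sum; last exact: udwi.
  rewrite mulNr -mulrN -sumrN; congr (_ * _); apply: eq_bigr => i _.
  by rewrite dmollify_adjoint.
rewrite EFinM; apply: lee_wpmul2l; first by rewrite lee_fin ltW.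
apply: ereal_sup_ubound; exists (mollify_field e w).
  split; first exact: (mollify_field_C1c e0 e1 wi w_supp Ar AO).
  apply: (mollify_field_le1 e0 e1 wi _ _ w_le); first by rewrite invr_ge0 ltW.
  by rewrite mulVf// gt_eqF.
transitivity (\int[mu]_y (\sum_i uu y * dmollify e (w i) y 0 i)%:E)%E.
  rewrite integral_mkcond; apply: eq_integral => y _.
  rewrite patchE /uu patchE; case: ifPn => _.
    by rewrite divergence_mollify_field// mulr_sumr.
  by rewrite big1// => i _; rewrite mul0r.
by rewrite /Rintegral fineK//; exact: (integrable_fin_num measurableT).
Qed.

End mollified_variation.

(** * Convergence of mollifications in L^1 *)

Section L1_distance.
Context d (T : measurableType d) (R : realType).
Variable mu : {measure set T -> \bar R}.
Implicit Types f g : T -> R.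

Definition L1n f : R := \int[mu]_x `|f x|.

Lemma L1n_ge0 f : 0 <= L1n f.
Proof. exact: Rintegral_ge0. Qed.

Lemma EFin_L1n f : mu.-integrable setT (EFin \o f) ->
  (L1n f)%:E = (\int[mu]_x (`|f x|%R)%:E)%E.
Proof.
move=> fi; rewrite /L1n /Rintegral fineK//.
exact: (integrable_fin_num measurableT (integrable_norm fi)).
Qed.

Lemma integrableDR f g : mu.-integrable setT (EFin \o f) ->
  mu.-integrable setT (EFin \o g) ->
  mu.-integrable setT (EFin \o (fun x => f x + g x)).
Proof. by move=> fi gi; move: (integrableD measurableT fi gi). Qed.

Lemma integrableZR c f : mu.-integrable setT (EFin \o f) ->
  mu.-integrable setT (EFin \o (fun x => c * f x)).
Proof. by move=> fi; move: (integrableZl measurableT c fi). Qed.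

Lemma integrableBR f g : mu.-integrable setT (EFin \o f) ->
  mu.-integrable setT (EFin \o g) ->
  mu.-integrable setT (EFin \o (fun x => f x - g x)).
Proof. by move=> fi gi; move: (integrableB measurableT fi gi). Qed.

Lemma integrable_sumR (I : Type) (s : seq I) (h : I -> T -> R) :
  (forall i, mu.-integrable setT (EFin \o h i)) ->
  mu.-integrable setT (EFin \o (fun x => \sum_(i <- s) h i x)).
Proof.
move=> hi; rewrite (_ : _ \o _ = (fun x => \sum_(i <- s) (h i x)%:E)%E).
  by apply: integrable_sum => // i _; exact: hi.
by apply/funext => y /=; rewrite sumEFin.
Qed.

Lemma L1nD f g : mu.-integrable setT (EFin \o f) ->
  mu.-integrable setT (EFin \o g) ->
  L1n (fun x => f x + g x) <= L1n f + L1n g.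
Proof.
move=> fi gi; rewrite /L1n -RintegralD//; try exact: integrable_norm.
apply: le_Rintegral => //.
- by apply: integrable_norm; exact: integrableDR.
- by apply: integrableDR; exact: integrable_norm.
- by move=> x _; exact: ler_normD.
Qed.

Lemma L1nZ c f : mu.-integrable setT (EFin \o f) ->
  L1n (fun x => c * f x) = `|c| * L1n f.
Proof.
move=> fi; rewrite /L1n -RintegralZl//; last exact: integrable_norm.
by apply: eq_Rintegral => x _; rewrite normrM.
Qed.

Lemma integrable_indicP (A : set T) : measurable A ->
  mu.-integrable setT (EFin \o (\1_A : T -> R)) -> (mu A < +oo)%E.
Proof.
move=> mA /integrableP[_].
under eq_integral do rewrite /= ger0_norm ?ler0n//.
by rewrite integral_indic// setIT.
Qed.

End L1_distance.

Section approximate_identity.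
Context (R : realType) (N : nat).
Local Notation V := 'rV[R]_N.+1.
Local Notation L := (lebesgue_rV R N).
Local Notation mu := (@lebesgue R N : {measure set L -> \bar R}).
Local Notation integrable f := (mu.-integrable setT (EFin \o f : L -> \bar R)).
Local Notation n1 := (@L1n _ L R mu).
Implicit Types (w v : V -> R) (e : R).

Lemma mollify_integrable e w : 0 <= e -> e <= 1 -> integrable w ->
  integrable (mollify e w).
Proof.
move=> e0 e1 wi; apply/integrableP; split.
  apply/measurable_EFinP; exact: (measurable_continuous (mollify_continuous e0 e1 wi)).
apply: (le_lt_trans (integral_mollify_le e0 e1 wi)).
apply: lte_mul_pinfty; first by rewrite lee_fin mass_ge0.
  by [].
by move/integrableP : wi => [].
Qed.

Lemma mollify_L1_le e w : 0 <= e -> e <= 1 -> integrable w ->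
  n1 (mollify e w) <= mass N e * n1 w.
Proof.
move=> e0 e1 wi; rewrite -lee_fin EFinM !EFin_L1n//.
  exact: integral_mollify_le.
exact: mollify_integrable.
Qed.

Definition mollify_err e w : R := n1 (fun x => mollify e w x - mass N e * w x).

Lemma mollify_err_integrable e w : 0 <= e -> e <= 1 -> integrable w ->
  integrable (fun x => mollify e w x - mass N e * w x).
Proof.
move=> e0 e1 wi; apply: integrableBR; first exact: mollify_integrable.
exact: integrableZR.
Qed.

Lemma mollify_err_le e w : 0 <= e -> e <= 1 -> integrable w ->
  mollify_err e w <= 2 * mass N e * n1 w.
Proof.
move=> e0 e1 wi; have mi := mollify_integrable e0 e1 wi.
rewrite /mollify_err.
have -> : (fun x => mollify e w x - mass N e * w x) =
    (fun x => mollify e w x + (- mass N e) * w x).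
  by apply/funext => x; rewrite mulNr.
apply: le_trans (L1nD mi (integrableZR _ wi)) _.
rewrite L1nZ// normrN (ger0_norm (mass_ge0 _ _)).
have := mollify_L1_le e0 e1 wi; clear; lra.
Qed.

Lemma mollify_errD e w v : 0 <= e -> e <= 1 -> integrable w -> integrable v ->
  mollify_err e (fun x => w x + v x) <= mollify_err e w + mollify_err e v.
Proof.
move=> e0 e1 wi vi; rewrite /mollify_err.
have -> : (fun x => mollify e (fun x => w x + v x) x - mass N e * (w x + v x)) =
    (fun x => (mollify e w x - mass N e * w x) + (mollify e v x - mass N e * v x)).
  apply/funext => x; rewrite mulrDr opprD addrACA; congr (_ + _).
  rewrite /mollify -RintegralD; try exact: mollify_integrand; last exact: measurableT.
  by apply: eq_Rintegral => z _; rewrite mulrDl.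
by apply: L1nD; exact: mollify_err_integrable.
Qed.

Lemma mollify_errZ e c w : 0 <= e -> e <= 1 -> integrable w ->
  mollify_err e (fun x => c * w x) = `|c| * mollify_err e w.
Proof.
move=> e0 e1 wi; rewrite -L1nZ; last exact: mollify_err_integrable.
rewrite /mollify_err; congr L1n; apply/funext => x.
rewrite mulrBr mulrCA; congr (_ - _).
rewrite /mollify -RintegralZl; try exact: mollify_integrand; last exact: measurableT.
by apply: eq_Rintegral => z _; rewrite mulrA.
Qed.

(** The mollifications of w, divided by the mass of the kernel, converge to w in
    L^1. The class is closed under linear combinations and L^1 limits, so
    membership of all integrable functions follows from that of a dense family:
    first Lipschitz functions of bounded support, then indicators of boxes, then
    indicators of sets of finite measure. *)
Definition mollifiable w := integrable w /\ forall r, 0 < r ->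
  exists2 s, 0 < s & forall e, 0 < e -> e <= 1 -> e <= s ->
    mollify_err e w <= mass N e * r.

Lemma mollifiable_closed w : integrable w ->
  (forall r, 0 < r -> exists2 v, mollifiable v & n1 (fun x => w x - v x) <= r) ->
  mollifiable w.
Proof.
move=> wi wv; split=> // r r0.
have r3 : 0 < r / 3 by rewrite divr_gt0.
have [v [vi vm] wvr] := wv _ r3.
have [s s0 sv] := vm _ r3.
exists s => // e e0 e1 es; have e0' := ltW e0.
have := @mollify_errD e (fun x => w x - v x) v e0' e1 (integrableBR wi vi) vi.
have -> : (fun x => w x - v x + v x) = w by apply/funext => x; rewrite subrK.
have := mollify_err_le e0' e1 (integrableBR wi vi).
have := sv e e0 e1 es.
have := ler_wpM2l (mass_ge0 N e) wvr.
clear; lra.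
Qed.

Lemma mollifiableD w v : mollifiable w -> mollifiable v ->
  mollifiable (fun x => w x + v x).
Proof.
move=> [wi wm] [vi vm]; split; first exact: integrableDR.
move=> r r0; have r2 : 0 < r / 2 by rewrite divr_gt0.
have [s s0 sw] := wm _ r2; have [t t0 tv] := vm _ r2.
exists (Num.min s t); first by rewrite lt_min s0.
move=> e e0 e1; rewrite le_min => /andP[es et].
have := mollify_errD (ltW e0) e1 wi vi.
have := sw e e0 e1 es; have := tv e e0 e1 et.
clear; lra.
Qed.

Lemma mollifiableZ c w : mollifiable w -> mollifiable (fun x => c * w x).
Proof.
move=> [wi wm]; split; first exact: integrableZR.
move=> r r0; have c0 : 0 < `|c| + 1 by rewrite ltr_wpDl.
have [s s0 sw] := wm _ (divr_gt0 r0 c0).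
exists s => // e e0 e1 es; rewrite (mollify_errZ _ (ltW e0) e1 wi).
apply: (@le_trans _ _ ((`|c| + 1) * (mass N e * (r / (`|c| + 1))))).
  rewrite ler_pM//; [exact: L1n_ge0|by rewrite lerDl|exact: sw].
by rewrite mulrCA (mulrC _ (r / _)) divfK// gt_eqF.
Qed.

Lemma mollifiable0 : mollifiable (fun=> 0).
Proof.
have i0 : integrable (fun=> 0) by exact: integrable0.
split=> // r r0; exists 1 => // e e0 e1 _.
have := mollify_err_le (ltW e0) e1 i0.
have -> : n1 (fun=> 0) = 0.
  rewrite /L1n -[RHS](mul0r (fine (mu setT))) -Rintegral_cst//.
  by apply: eq_Rintegral => x _; rewrite normr0.
rewrite mulr0 => /le_trans; apply.
by rewrite mulr_ge0 ?mass_ge0// ltW.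
Qed.

Lemma mollifiable_sum (I : Type) (s : seq I) (h : I -> V -> R) :
  (forall i, mollifiable (h i)) -> mollifiable (fun x => \sum_(i <- s) h i x).
Proof.
move=> hm; elim: s => [|i s ih].
  by under eq_fun do rewrite big_nil; exact: mollifiable0.
under eq_fun do rewrite big_cons.
exact: mollifiableD.
Qed.

End approximate_identity.

Section L1_density.
Context d (T : measurableType d) (R : realType).
Variable mu : {measure set T -> \bar R}.

(** If a cover of A is nearly optimal, the sum S of the indicators of its members
    exceeds 1_A by little in L^1, and it exceeds its partial sums by a tail of a
    convergent series. *)
Lemma indicator_cover_approx (A : set T) (F : (set T)^nat) (r : R) :
    measurable A -> (forall k, measurable (F k)) -> (mu A < +oo)%E ->
    A `<=` \bigcup_k F k -> 0 < r ->
    (\sum_(k <oo) mu (F k) <= mu A + r%:E)%E ->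
  exists K, (\int[mu]_x (`|\1_A x - \sum_(0 <= k < K) \1_(F k) x|)%:E <= (2 * r)%:E)%E.
Proof.
move=> mA mF Aoo AF r0 Fr.
have fA : mu A \is a fin_num by rewrite ge0_fin_numE.
have Foo : (\sum_(k <oo) mu (F k) < +oo)%E.
  by rewrite (le_lt_trans Fr)// lte_add_pinfty ?ltry.
have r0e : (0 < r%:E)%E by rewrite lte_fin.
have [K _ tailK] := nneseries_tail_cvg Foo (fun k _ => measure_ge0 mu (F k))
  (open_ereal_lt' r0e).
have {}tailK : (\sum_(k <oo) mu (F (k + K)%N) <= r%:E)%E.
  rewrite (nneseries_addn (f := fun k => mu (F k)))//.
  by rewrite ltW//; apply: tailK => /=.
exists K.
pose D x : R := `|\1_A x - \sum_(0 <= k < K) \1_(F k) x|.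
pose t x : \bar R := (\sum_(k <oo) (\1_(F (k + K)%N) x)%:E)%E.
pose s x : \bar R := (\sum_(0 <= k < K) (\1_(F k) x)%:E)%E.
have i0 (B : set T) x : (0 <= (\1_B x : R)%:E)%E by rewrite lee_fin indicE ler0n.
have t0 x : (0 <= t x)%E by apply: nneseries_ge0.
have s0 x : (0 <= s x)%E by rewrite /s sume_ge0.
have mi (B : set T) : measurable B -> measurable_fun setT (fun x => (\1_B x : R)%:E).
  by move=> mB; apply/measurable_EFinP; exact: measurable_indic.
have mt : measurable_fun setT t.
  exact: (ge0_emeasurable_sum (P := xpredT) (fun k x _ _ => i0 _ _)
    (fun k _ => mi _ (mF _))).
have ms : measurable_fun setT s.
  by apply: emeasurable_sum; move=> k; exact: mi.
have mD : measurable_fun setT (fun x => (D x)%:E).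
  apply/measurable_EFinP; apply: measurableT_comp => //.
  apply: measurable_funB; first exact: measurable_indic.
  by apply: measurable_sum => k; exact: measurable_indic.
(* adding 1_A on the left and a second tail on the right avoids subtracting
   sums that may be infinite *)
have key x : (((D x)%:E + (\1_A x : R)%:E) <= s x + (t x + t x))%E.
  have sE : s x = (\sum_(0 <= k < K) \1_(F k) x)%:E by rewrite /s sumEFin.
  rewrite sE /D; set g := \sum_(0 <= k < K) _.
  have g0 : 0 <= g by apply: sumr_ge0 => k _; rewrite indicE ler0n.
  have [xA|xA] := pselect (A x); last first.
    rewrite indicE memNset// sub0r normrN ger0_norm// adde0.
    by rewrite leeDl// adde_ge0.
  rewrite indicE mem_set// -EFinD.
  have [k _ Fkx] := AF x xA.
  have [kK|Kk] := ltnP k K.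
    have g1 : 1 <= g.
      rewrite /g (bigD1_seq k) ?iota_uniq ?mem_index_iota//=.
      by rewrite indicE mem_set// lerDl sumr_ge0// => j _; rewrite indicE ler0n.
    rewrite distrC ger0_norm ?subr_ge0// subrK.
    by rewrite leeDl// adde_ge0.
  have t1 : (1 <= t x)%E.
    apply: le_trans (nneseries_lim_ge (k - K).+1 _) => [|i _ _]; last exact: i0.
    rewrite big_nat_recr//= subnK// indicE mem_set//.
    by rewrite leeDr// sume_ge0.
  have h : `|1 - g| + 1 <= g + (1 + 1).
    have := ler_normB 1 g; rewrite normr1 (ger0_norm g0); clear; lra.
  rewrite (@le_trans _ _ (g + (1 + 1))%:E)//.
  by rewrite EFinD leeD2l// EFinD leeD.
have := ge0_le_integral mu measurableT _ _ _ (fun x _ => key x).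
rewrite ge0_integralD//; last 2 first.
- by move=> x _; rewrite lee_fin normr_ge0.
- exact: mi.
rewrite integral_indic// setIT.
rewrite ge0_integralD//; last 2 first.
- by move=> x _; rewrite adde_ge0.
- exact: emeasurable_funD.
rewrite ge0_integralD//.
have -> : (\int[mu]_x s x = \sum_(0 <= k < K) mu (F k))%E.
  rewrite ge0_integral_sum//; last by move=> k; exact: mi.
  by apply: eq_bigr => k _; rewrite integral_indic// setIT.
have -> : (\int[mu]_x t x = \sum_(k <oo) mu (F (k + K)%N))%E.
  rewrite integral_nneseries//; last by move=> k; exact: mi.
  by apply: eq_eseriesr => k _; rewrite integral_indic// setIT.
move=> H.
have {}H : (\int[mu]_x (D x)%:E + mu A <= mu A + (2 * r)%:E)%E.
  apply: le_trans (H _ _ _) _.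
  - by move=> x _; rewrite adde_ge0// lee_fin normr_ge0.
  - by apply: emeasurable_funD => //; exact: mi.
  - by apply: emeasurable_funD => //; exact: emeasurable_funD.
  have E := nneseries_split 0 K (fun k _ => measure_ge0 mu (F k)).
  rewrite add0n -(nneseries_addn (f := fun k => mu (F k)) K)// in E.
  rewrite addeA mulr_natl mulr2n EFinD addeA; apply: leeD; last exact: tailK.
  by apply: le_trans Fr; rewrite E.
by move: H; rewrite addeC leeD2lE.
Qed.

Import HBSimple.

(** Induction over integrable functions through simple functions. *)
Lemma integrable_L1_ind (P : (T -> R) -> Prop) :
    (forall A, measurable A -> (mu A < +oo)%E -> P \1_A) ->
    P (fun=> 0) ->
    (forall f g, P f -> P g -> P (fun x => f x + g x)) ->
    (forall c f, P f -> P (fun x => c * f x)) ->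
    (forall f, mu.-integrable setT (EFin \o f) ->
      (forall r, 0 < r -> exists2 g, mu.-integrable setT (EFin \o g) &
         P g /\ L1n mu (fun x => f x - g x) <= r) -> P f) ->
  forall f, mu.-integrable setT (EFin \o f) -> P f.
Proof.
move=> P1 P0 PD PZ Pcl f fi; apply: Pcl => // r r0.
have [g [gi _ gf]] := approximation_sfun_integrable measurableT fi.
have r0e : (0 < r%:E)%E by rewrite lte_fin.
have [n _ gn] := gf _ (open_ereal_lt' r0e).
exists (g n); first exact: gi.
split; last first.
  rewrite -lee_fin EFin_L1n; last by apply: integrableBR => //; exact: gi.
  by apply: ltW; exact: (gn n (leqnn n)).
have -> : (g n : T -> R) =
  (fun x => \sum_(y <- finmap.enum_fset (fset_set (range (g n))))
     y * \1_(g n @^-1` [set y]) x).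
  by apply/funext => x; rewrite {1}fimfunE fsbig_finite.
have Ph y : P (fun x => y * \1_(g n @^-1` [set y]) x).
  have [->|y0] := eqVneq y 0.
    by under eq_fun do rewrite mul0r; exact: P0.
  apply: PZ; have mB : measurable (g n @^-1` [set y]) by exact: measurable_sfunP.
  apply: P1 => //; apply: integrable_indicP => //.
  have : mu.-integrable setT (EFin \o (fun x => y^-1 * (y * \1_(g n @^-1` [set y]) x))).
    apply: integrableZR; apply: (le_integrable measurableT _ _ (gi n)).
      apply/measurable_EFinP; apply: measurable_funM; first exact: measurable_cst.
      exact: (@measurable_indic _ T R setT _ mB).
    move=> x _ /=; rewrite lee_fin normrM indicE.
    have [gx|gx] := pselect ((g n @^-1` [set y]) x).
      by rewrite mem_set// normr1 mulr1 -gx.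
    by rewrite memNset// normr0 mulr0.
  by under eq_fun do rewrite mulKf//.
elim: (finmap.enum_fset _) => [|y s ih].
  by under eq_fun do rewrite big_nil; exact: P0.
under eq_fun do rewrite big_cons.
exact: PD.
Qed.

End L1_density.

Section approximate_identity_theorem.
Context (R : realType) (N : nat).
Local Notation V := 'rV[R]_N.+1.
Local Notation L := (lebesgue_rV R N).
Local Notation mu := (@lebesgue R N : {measure set L -> \bar R}).
Local Notation integrable f := (mu.-integrable setT (EFin \o f : L -> \bar R)).
Local Notation n1 := (@L1n _ L R mu).
Implicit Types (w v : V -> R) (e : R).

Lemma measurable_lipschitz v (K : R) :
  (forall x h, `|v (x + h) - v x| <= K * enorm h) ->
  measurable_fun setT (v : L -> R).
Proof.
move=> vK; apply: measurable_continuous => x.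
by apply: (@lipschitz_at_continuous _ _ _ _ _ K) => h _; exact: vK.
Qed.

(** The error at x averages v z - v x over |z - x| < e, so it is at most K * e,
    and it vanishes outside a fixed cube. *)
Lemma mollifiable_lipschitz v (K B r : R) :
    (forall x h, `|v (x + h) - v x| <= K * enorm h) -> (forall x, `|v x| <= B) ->
    (forall x, r <= enorm x -> v x = 0) ->
  mollifiable v.
Proof.
move=> vK vB vr; have mv := measurable_lipschitz vK.
have K0 : 0 <= K.
  have := le_trans (normr_ge0 _) (vK 0 (delta_mx 0 0)).
  rewrite enormE dot_delta mxE !eqxx sqrtr1 mulr1; exact.
have vi : integrable v by exact: (integrable_bounded_support mv vB vr).
split=> // s s0; pose b : R := fine (mu (cube (r + 1))).
have b0 : 0 <= b by apply: fine_ge0; exact: measure_ge0.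
have Kb : 0 < K * b + 1 by rewrite ltr_wpDl// mulr_ge0.
(* the error is at most K * e * mass on a cube of measure b *)
exists (s / (K * b + 1)); first exact: divr_gt0.
move=> e e0 e1 es; have e0' := ltW e0.
have m0 : 0 <= mass N e := mass_ge0 N e.
have mc : measurable (cube (r + 1) : set L) by exact: measurable_box.
have ic : integrable (\1_(cube (r + 1) : set V) : V -> R).
  by apply: integrable_indic_lty; [exact: mc|exact: lebesgue_box_lty].
have pw x : `|mollify e v x - mass N e * v x| <=
    K * e * mass N e * \1_(cube (r + 1) : set V) x.
  have vxi : integrable (fun z => moll e (x - z)) by exact: mollBr_integrable.
  have vdi : integrable (fun z => (v z - v x) * moll e (x - z)).
    have := integrableBR (mollify_integrand e0' e1 vi x) (integrableZR (v x) vxi).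
    by under eq_fun do rewrite -mulrBl.
  have -> : mollify e v x - mass N e * v x = \int[mu]_z ((v z - v x) * moll e (x - z)).
    rewrite -(Rintegral_mollBr e0' e1 x) mulrC -RintegralZl; last 2 first.
    - exact: measurableT.
    - exact: vxi.
    rewrite /mollify -RintegralB; last 3 first.
    - exact: measurableT.
    - exact: mollify_integrand.
    - exact: integrableZR.
    by apply: eq_Rintegral => z _; rewrite mulrBl.
  have [xr|xr] := leP (r + 1) (enorm x).
    rewrite (_ : Rintegral _ _ _ = 0).
      by rewrite normr0 !mulr_ge0// ?indicE.
    transitivity (\int[mu]_z (0 : R)); last by rewrite Rintegral_cst// mul0r.
    apply: eq_Rintegral => z _.
    have [ex|ex] := leP e (enorm (x - z)); first by rewrite moll_eq0// mulr0.
    rewrite !vr ?subrr ?mul0r//.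
      by rewrite (le_trans _ xr)// lerDl.
    have := enormD (x - z) z; rewrite subrK; clear -xr ex e1; lra.
  rewrite indicE mem_set; last first.
    by apply: cube_norm; exact: le_lt_trans (norm_le_enorm _) xr.
  rewrite mulr1 (le_trans (le_normr_Rintegral measurableT vdi))//.
  rewrite -(Rintegral_mollBr e0' e1 x) -RintegralZl; last 2 first.
  - exact: measurableT.
  - exact: vxi.
  apply: le_Rintegral; [exact: measurableT|exact: integrable_norm| |].
    exact: integrableZR.
  move=> z _; rewrite normrM (ger0_norm (moll_ge0 _ _)).
  have [ex|ex] := leP e (enorm (x - z)); first by rewrite moll_eq0// !mulr0.
  rewrite ler_wpM2r ?moll_ge0//.
  have := vK z (x - z); rewrite (addrC z) subrK distrC => /le_trans; apply.
  by rewrite ler_wpM2l// ltW.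
apply: (@le_trans _ _ (\int[mu]_x (K * e * mass N e * \1_(cube (r + 1) : set V) x))).
  apply: le_Rintegral; [exact: measurableT| | |by move=> x _; exact: pw].
  - by apply: integrable_norm; exact: mollify_err_integrable.
  - exact: integrableZR.
rewrite RintegralZl; [|exact: measurableT|exact: ic].
have -> : \int[mu]_x (\1_(cube (r + 1) : set V) x : R) = b.
  by rewrite /Rintegral integral_indic; [rewrite setIT|exact: measurableT|exact: mc].
rewrite (mulrC _ (mass N e)) -mulrA ler_wpM2l//.
move: es; rewrite ler_pdivlMr// => /(le_trans _); apply.
rewrite mulrDr mulr1 mulrAC mulrC -[leLHS]addr0 lerD//.
Qed.

(** The indicator of ]a, b] is the pointwise limit of these Lipschitz functions,
    the end points included: the left foot sits at a and the right shoulder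
    at b. *)
Definition ramp (n : nat) (a b t : R) : R :=
  Num.max 0 (Num.min 1 (Num.min (n%:R * (t - a)) (1 + n%:R * (b - t)))).

Lemma ramp_ge0 n a b t : 0 <= ramp n a b t.
Proof. by rewrite /ramp le_max lexx. Qed.

Lemma ramp_le1 n a b t : ramp n a b t <= 1.
Proof. by rewrite /ramp ge_max ler01 ge_min lexx. Qed.

Lemma ler_dist_min (a b c d D : R) : `|a - c| <= D -> `|b - d| <= D ->
  `|Num.min a b - Num.min c d| <= D.
Proof.
rewrite !ler_norml /Num.min => /andP[h1 h2] /andP[h3 h4].
by do 2 case: ifPn; rewrite -?leNgt => h5 h6; apply/andP; split; lra.
Qed.

Lemma ramp_lip n a b t s : `|ramp n a b s - ramp n a b t| <= n%:R * `|s - t|.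
Proof.
have D0 : 0 <= n%:R * `|s - t| by rewrite mulr_ge0.
have cap (p q D : R) : 0 <= D -> `|p - q| <= D -> `|Num.max 0 p - Num.max 0 q| <= D.
  move=> {}D0; rewrite !ler_norml /Num.max => /andP[h1 h2].
  by do 2 case: ifPn; rewrite -?leNgt => h5 h6; apply/andP; split; lra.
apply: cap => //; apply: ler_dist_min; first by rewrite subrr normr0.
apply: ler_dist_min.
  rewrite (_ : _ - _ = n%:R * (s - t)); last by ring.
  by rewrite normrM (ger0_norm (ler0n _ _)).
rewrite (_ : _ - _ = n%:R * (t - s)); last by ring.
by rewrite normrM (ger0_norm (ler0n _ _)) distrC.
Qed.

Lemma ramp_eq0 n a b t : (0 < n)%N -> t \notin `]a, b + 1] -> ramp n a b t = 0.
Proof.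
move=> n0; rewrite in_itv/= negb_and -!leNgt -ltNge => tab.
have n1 : 1 <= n%:R :> R by rewrite ler1n.
apply/eqP; rewrite eq_le ramp_ge0 andbT /ramp ge_max lexx/= !ge_min.
case/orP: tab => h; first by rewrite mulr_ge0_le0 ?subr_le0// orbT.
apply/orP; right; apply/orP; right; nra.
Qed.

Lemma ramp_cvg a b t : \forall n \near \oo, ramp n a b t = \1_`]a, b]%classic t.
Proof.
rewrite indicE; have [|] := boolP (t \in `]a, b]).
  move=> tab; rewrite mem_set//=; move: tab; rewrite in_itv/= => /andP[ta tb].
  exists (Num.bound (t - a)^-1) => // n /= nb.
  have h1 : 1 <= n%:R * (t - a).
    rewrite -ler_pdivrMr ?subr_gt0// mul1r.
    rewrite (le_trans (ltW (archi_boundP _))) ?invr_ge0 ?subr_ge0 ?(ltW ta)//.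
    by rewrite ler_nat.
  have h2 : 0 <= n%:R * (b - t) by rewrite mulr_ge0// subr_ge0.
  rewrite /ramp (@min_l _ _ 1); last by rewrite le_min h1 lerDl h2.
  by rewrite max_r.
move=> tab; rewrite memNset; last by move=> /= tab'; rewrite tab' in tab.
move: tab; rewrite in_itv/= negb_and -leNgt -ltNge => /orP[ta|bt].
  exists 0%N => // n _; apply/eqP; rewrite eq_le ramp_ge0 andbT.
  by rewrite /ramp ge_max lexx/= !ge_min mulr_ge0_le0 ?subr_le0// orbT.
exists (Num.bound (t - b)^-1) => // n /= nb.
have h1 : 1 <= n%:R * (t - b).
  rewrite -ler_pdivrMr ?subr_gt0// mul1r.
  rewrite (le_trans (ltW (archi_boundP _))) ?invr_ge0 ?subr_ge0 ?(ltW bt)//.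
  by rewrite ler_nat.
apply/eqP; rewrite eq_le ramp_ge0 andbT /ramp ge_max lexx/= !ge_min.
apply/orP; right; apply/orP; right.
rewrite (_ : n%:R * (b - t) = - (n%:R * (t - b))); last by rewrite -mulrN opprB.
by rewrite subr_le0.
Qed.

Lemma ler_norm_prodB (I : Type) (s : seq I) (f g : I -> R) :
  (forall i, 0 <= f i <= 1) -> (forall i, 0 <= g i <= 1) ->
  `|\prod_(i <- s) f i - \prod_(i <- s) g i| <= \sum_(i <- s) `|f i - g i|.
Proof.
move=> f01 g01; elim: s => [|i s ih]; first by rewrite !big_nil subrr normr0.
rewrite !big_cons.
have F1 : `|\prod_(j <- s) f j| <= 1.
  rewrite ger0_norm; last by apply: prodr_ge0 => j _; case/andP: (f01 j).
  by apply: prodr_ile1 => j _.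
rewrite (_ : _ - _ = (f i - g i) * \prod_(j <- s) f j +
  g i * (\prod_(j <- s) f j - \prod_(j <- s) g j)); last by ring.
rewrite (le_trans (ler_normD _ _))// !normrM lerD//.
  by rewrite ler_piMr.
have /andP[g0 g1] := g01 i.
by rewrite (le_trans _ ih)// ger0_norm// ler_piMl.
Qed.

Lemma mollifiable_box (ab : V * V) : mollifiable (\1_(box ab) : V -> R).
Proof.
have mb : measurable (box ab : set L) by exact: measurable_box.
have bi : integrable (\1_(box ab) : V -> R).
  by apply: integrable_indic_lty; [exact: mb|exact: lebesgue_box_lty].
apply: mollifiable_closed => // r r0.
pose v (n : nat) (x : V) : R := \prod_(i < N.+1) ramp n (ab.1 0 i) (ab.2 0 i) (x 0 i).
have r01 (n : nat) i (x : V) : 0 <= ramp n (ab.1 0 i) (ab.2 0 i) (x 0 i) <= 1.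
  by rewrite ramp_ge0 ramp_le1.
have v0 n (x : V) : 0 <= v n x by apply: prodr_ge0 => i _; case/andP: (r01 n i x).
have v1 n (x : V) : `|v n x| <= 1.
  rewrite ger0_norm//.
  by apply: prodr_ile1 => i _.
have vlip n (x h : V) : `|v n (x + h) - v n x| <= (n%:R * N.+1%:R) * enorm h.
  apply: (le_trans (ler_norm_prodB _ _ _)) => [i|i|]; try exact: r01.
  rewrite mulrAC mulr_natr -[X in _ *+ X](card_ord N.+1) -sumr_const.
  apply: ler_sum => i _; apply: (le_trans (ramp_lip _ _ _ _ _)).
  rewrite (_ : (x + h) 0 i - x 0 i = h 0 i).
    by rewrite ler_wpM2l// coord_le_enorm.
  by rewrite mxE addrC addKr.
(* for n > 0 the ramps vanish outside ]a, b + 1], hence a dominating indicator *)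
pose cd : V * V := (ab.1, \row_i (ab.2 0 i + 1)).
have vcd n (x : V) : (0 < n)%N -> ~ box cd x -> v n x = 0.
  move=> n0 /existsNP[i /negP xi].
  rewrite /v (bigD1 i)//= ramp_eq0// ?mul0r//.
  by move: xi; rewrite /= mxE.
have icd : integrable (\1_(box cd) : V -> R).
  by apply: integrable_indic_lty; [exact: measurable_box|exact: lebesgue_box_lty].
have vm n : (0 < n)%N -> mollifiable (v n).
  move=> n0; pose M : R := enorm ab.1 + enorm cd.2.
  apply: (@mollifiable_lipschitz _ _ 1 (N.+1%:R * M + 1) (vlip n)) => // x xM.
  apply: vcd => // xcd.
  have : `|x| <= M.
    apply: rV_norm_le => [|i]; first by rewrite addr_ge0 ?enorm_ge0.
    have := xcd i; rewrite in_itv/= => /andP[h1 h2].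
    have := coord_le_enorm ab.1 i; have := coord_le_enorm cd.2 i.
    rewrite !ler_norml /M; have := enorm_ge0 ab.1; have := enorm_ge0 cd.2.
    move: h1 h2; rewrite /cd/=; clear; lra.
  move=> xM'; have := enorm_le_norm x.
  have : N.+1%:R * `|x| <= N.+1%:R * M by rewrite ler_wpM2l.
  move: xM; clear; lra.
have vcv (x : V) : \forall n \near \oo, v n x = \1_(box ab) x.
  have h : \forall n \near \oo, forall i : 'I_N.+1,
      ramp n (ab.1 0 i) (ab.2 0 i) (x 0 i) = \1_`]ab.1 0 i, ab.2 0 i]%classic (x 0 i).
    by apply: filter_forall => i; exact: ramp_cvg.
  apply: filterS h => n h; rewrite /v (eq_bigr _ (fun i _ => h i)).
  rewrite indicE; have [xb|xb] := pselect (box ab x).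
    rewrite mem_set// big1// => i _; rewrite indicE mem_set//; exact: xb.
  rewrite memNset//; move: xb => /existsNP[i xi].
  by rewrite (bigD1 i)//= indicE memNset// mul0r.
have [||||_ dc _] := @dominated_convergence _ L R mu setT measurableT
  (fun n => EFin \o v n.+1) (EFin \o (\1_(box ab) : V -> R))
  (EFin \o (\1_(box cd) : V -> R)) _ _ _ icd.
- by move=> n; apply/measurable_EFinP; exact: measurable_lipschitz (vlip _).
- by apply/measurable_EFinP; exact: measurable_indic.
- apply: aeW => x _; apply: cvg_near_cst; have [n0 _ vn] := vcv x.
  by exists n0 => // n /= nn; rewrite vn//=; exact: leqW.
- apply: aeW => x n _ /=; rewrite lee_fin.
  rewrite indicE; have [xc|xc] := pselect (box cd x); first by rewrite mem_set.
  by rewrite vcd// normr0.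
have r0e : (0 < r%:E)%E by rewrite lte_fin.
have [n _ nr] := dc _ (open_ereal_lt' r0e).
exists (v n.+1); first exact: vm.
have vi : integrable (v n.+1) by case: (vm n.+1 isT).
rewrite -lee_fin EFin_L1n; last exact: integrableBR.
apply: ltW; have := nr n (leqnn n) => /=; apply: le_lt_trans.
rewrite le_eqVlt; apply/orP; left; apply/eqP.
by apply: eq_integral => x _; rewrite distrC.
Qed.

Lemma mollifiable_indic (A : set V) : measurable (A : set L) -> (mu A < +oo)%E ->
  mollifiable (\1_A : V -> R).
Proof.
move=> mA Aoo.
have ai : integrable (\1_A : V -> R) by exact: integrable_indic_lty.
apply: mollifiable_closed => // r r0.
have r2 : 0 < r / 2 by rewrite divr_gt0.
have fA : mu A \is a fin_num by rewrite ge0_fin_numE.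
have [_ [F AF <-] ltF] := lb_ereal_inf_adherent r2 fA.
have mF k : measurable (box (F k) : set L) by exact: measurable_box.
have [K AK] : exists K, (\int[mu]_x
    (`|\1_A x - \sum_(0 <= k < K) \1_(box (F k)) x|)%:E <= (2 * (r / 2))%:E)%E.
  apply: (@indicator_cover_approx _ L R mu A (fun k => box (F k))) => //.
  apply: le_trans (ltW ltF); apply: lee_nneseries => k _.
    by move=> _; exact: measure_ge0.
  exact: lebesgue_box_le.
exists (fun x => \sum_(0 <= k < K) \1_(box (F k)) x).
  by apply: mollifiable_sum => k; exact: mollifiable_box.
have Fi : integrable (fun x => \sum_(0 <= k < K) \1_(box (F k)) x : R).
  apply: integrable_sumR => k.
  by apply: integrable_indic_lty; [exact: mF|exact: lebesgue_box_lty].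
rewrite -lee_fin EFin_L1n; last exact: integrableBR.
by rewrite (_ : r = 2 * (r / 2))// mulrC divfK.
Qed.

(** Mollification is an approximate identity in L^1. *)
Theorem integrable_mollifiable w : integrable w -> mollifiable w.
Proof.
move: w; apply: (@integrable_L1_ind _ L R mu (@mollifiable R N)).
- exact: mollifiable_indic.
- exact: mollifiable0.
- by move=> f g; exact: mollifiableD.
- by move=> c f; exact: mollifiableZ.
- move=> f fi fr; apply: mollifiable_closed => // r r0.
  by have [g _ [gm gr]] := fr r r0; exists g.
Qed.

End approximate_identity_theorem.

(** * Bounded push-forwards and Lipschitz trajectories *)

Section pushforward_bound.
Context d (T : measurableType d) (R : realType).
Variable mu : {measure set T -> \bar R}.

(** The hypothesis says that the image under psi of the restriction of mu to D is
    bounded by c times that restriction; integrate F against both measures. *)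
Lemma integral_comp_le (D : set T) (psi : T -> T) (c : R) (F : T -> \bar R) :
    measurable D -> set_fun D D psi -> measurable_fun D psi -> 0 <= c ->
    (forall A, measurable A -> A `<=` D ->
      (mu (D `&` psi @^-1` A) <= c%:E * mu A)%E) ->
    measurable_fun setT F -> (forall x, (0 <= F x)%E) ->
  (\int[mu]_(x in D) F (psi x) <= c%:E * \int[mu]_(x in D) F x)%E.
Proof.
move=> mD Dpsi mpsi c0 psic mF F0.
(* extended by the value x0 outside D, psi becomes a total map for which D is
   its own preimage *)
have [x0 x0D] : exists x0, D x0 -> D = setT.
  have [->|nDT] := pselect (D = setT); first by exists point.
  have /existsNP[x0 x0D] : ~ forall x, D x.
    by move=> h; apply: nDT; rewrite -subTset => x _; exact: h.
  by exists x0 => /x0D.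
pose psi' x := if x \in D then psi x else x0.
have psi'D : psi' @^-1` D = D.
  apply/seteqP; split => x; rewrite /psi' /=.
    case: ifPn => [/set_mem//|_ /x0D ->//].
  by move=> Dx; rewrite mem_set//; exact: Dpsi.
have mpsi' : measurable_fun setT psi'.
  move=> _ Y mY; rewrite setTI.
  rewrite (_ : psi' @^-1` Y =
      (D `&` psi @^-1` Y) `|` (~` D `&` [set _ | Y x0])).
    apply: measurableU; first exact: mpsi.
    have [Yx|Yx] := pselect (Y x0).
      rewrite (_ : [set _ | Y x0] = setT); last by apply/seteqP; split.
      by rewrite setIT; exact: measurableC.
    by rewrite (_ : [set _ | Y x0] = set0) ?setI0//; apply/seteqP; split.
  apply/seteqP; split => x; rewrite /psi' /=.
    case: ifPn => [/set_mem Dx Yx|xD Yx]; first by left.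
    by right; split=> // Dx; move: xD; rewrite mem_set.
  by move=> [[Dx]|[nDx]]; [rewrite mem_set|rewrite memNset].
have push_le S : measurable S ->
    (mrestr (pushforward mu psi') mD S <= mscale (NngNum c0) (mrestr mu mD) S)%E.
  move=> mS; rewrite /mscale/= /mrestr /pushforward.
  rewrite (_ : psi' @^-1` _ = D `&` psi @^-1` (S `&` D)).
    by apply: psic; [exact: measurableI|exact: subIsetr].
  apply/seteqP; split => x /=.
    move=> [Sx Dx]; have Dx' : D x by rewrite -psi'D.
    by move: Sx Dx; rewrite /psi' mem_set.
  by move=> [Dx [Sx Dpx]]; rewrite /psi' mem_set.
have -> : (\int[mu]_(x in D) F (psi x) =
    \int[mrestr (pushforward mu psi') mD]_(x in D) F x)%E.
  have -> : (\int[mrestr (pushforward mu psi') mD]_(x in D) F x =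
      \int[pushforward mu psi']_(x in D) F x)%E.
    apply: eq_measure_integral => A mA AD.
    change (mu (psi' @^-1` (A `&` D)) = mu (psi' @^-1` A)).
    by rewrite setIidl.
  rewrite ge0_integral_pushforward//; last exact: measurable_funTS.
  by rewrite psi'D; apply: eq_integral => x Dx; rewrite /psi' /= Dx.
apply: le_trans (ge0_le_measure_integral push_le mD F0 mF) _.
  exact: mpsi'.
rewrite le_eqVlt; apply/orP; left; apply/eqP.
transitivity (c%:E * \int[mrestr mu mD]_(x in D) F x)%E.
  apply: (ge0_integral_mscale _ mD (NngNum c0)) => //; exact: measurable_funTS.
congr (_ * _)%E; apply: eq_measure_integral => A mA AD.
change (mu (A `&` D) = mu A).
by rewrite setIidl.
Qed.

End pushforward_bound.

Section speed_bound.
Context (R : realType) (N : nat).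
Local Notation V := 'rV[R]_N.+1.

Lemma derivable_within_dot (f : R -> V) (D : set R) (s : R) (w : V) (r : R) :
    derivable_within D f s -> 0 < r ->
  \forall t \near s, D t -> `|dot w (f t) - dot w (f s) -
    (t - s) * dot w (derive_within D f s)| <= r * `|t - s|.
Proof.
move=> df r0; set l := derive_within D f s.
pose W := \sum_i `|w 0 i| + 1.
have W0 : 0 < W by rewrite ltr_wpDl// sumr_ge0.
have dw x : `|dot w x| <= W * `|x|.
  rewrite /dot (le_trans (ler_norm_sum _ _ _))// /W mulrDl mul1r mulr_suml.
  rewrite -[leLHS]addr0 lerD//; apply: ler_sum => i _; rewrite normrM.
  by rewrite ler_wpM2l// rV_coord_le_norm.
have fl : (fun t => (t - s)^-1 *: (f t - f s)) @ within D s^' --> l by exact: df.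
have rW : 0 < r / W by exact: divr_gt0.
move/cvgrPdist_le : (fl) => /(_ _ rW)/nbhs_ballP[/= t t0 ht].
apply/nbhs_ballP; exists t => //= z sz Dz.
have [->|zs] := eqVneq z s; first by rewrite !subrr mul0r subrr normr0 mulr0.
have := ht z sz zs Dz; rewrite distrC.
have -> : dot w (f z) - dot w (f s) - (z - s) * dot w l =
    (z - s) * dot w ((z - s)^-1 *: (f z - f s) - l).
  rewrite !dotDr !dotNr dotZr dotDr dotNr mulrBr mulVKf// subr_eq0//.
rewrite normrM => h; rewrite mulrC ler_wpM2r//.
apply: le_trans (dw _) _.
by rewrite -ler_pdivlMl// mulrC.
Qed.

(** There is no mean value equality for vectors, but there is one for each scalar
    function s |-> w . f s, and unit vectors w suffice. *)
Lemma speed_lipschitz (f : R -> V) (M : R) :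
    (forall s, s \in `[0, 1] -> derivable_within `[0, 1] f s) ->
    (forall s, s \in `[0, 1] -> enorm (derive_within `[0, 1] f s) <= M) ->
  forall s t, 0 <= s -> s <= t -> t <= 1 -> enorm (f t - f s) <= M * (t - s).
Proof.
move=> df fM s t s0 st t1.
have M0 : 0 <= M.
  by apply: le_trans (enorm_ge0 _) (fM 0 _); rewrite in_itv/= lexx ler01.
apply: enorm_le_dot => [|w w1]; first by rewrite mulr_ge0// subr_ge0.
have [->|nst] := eqVneq s t.
  by rewrite !subrr mulr0 -(scale0r (0 : V)) dotZr mul0r.
have {nst}st : s < t by rewrite lt_neqAle nst.
rewrite dotDr dotNr.
pose D := derive_within `[0, 1]%classic f.
have inn x : x \in `[s, t] -> x \in `[0, 1].
  by rewrite !in_itv/= => /andP[h1 h2]; rewrite (le_trans s0 h1) (le_trans h2).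
have [x||x xst ->] := @MVT R (fun x => dot w (f x)) (fun x => dot w (D x)) s t st.
- move=> xst; have x01 : x \in `[0, 1].
    by apply: inn; move: xst; rewrite !in_itv/= => /andP[/ltW -> /ltW ->].
  have x01' : 0 < x < 1.
    move: xst; rewrite in_itv/= => /andP[h1 h2].
    by rewrite (le_lt_trans s0 h1) (lt_le_trans h2).
  have cv : k^-1 *: (((fun x => dot w (f x)) \o shift x) (k *: (1 : R^o)) -
      dot w (f x)) @[k --> 0^'] --> dot w (D x).
    apply/cvgrPdist_le => r r0.
    have /nbhs_ballP[/= q q0 hq] := derivable_within_dot w (df _ x01) r0.
    have [h0 h1] := andP x01'.
    pose p := Num.min q (Num.min x (1 - x)).
    have p0 : 0 < p by rewrite !lt_min q0 h0 subr_gt0.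
    near=> k.
    have k0 : k != 0 by near: k; exact: nbhs_dnbhs_neq.
    have : `|k| < p by near: k; exact: dnbhs0_lt.
    rewrite !lt_min => /and3P[kq kx kx1].
    have := hq (k + x); rewrite /ball/= opprD addrCA subrr addr0 normrN.
    move=> /(_ kq).
    have -> : `[0, 1]%classic (k + x).
      rewrite /= in_itv/=; move: kx kx1; rewrite !ltr_norml.
      by clear; move=> /andP[? ?] /andP[? ?]; apply/andP; split; lra.
    move=> /(_ isT); rewrite addrK /= => h.
    rewrite distrC (_ : k *: 1 + x = k + x); last by rewrite /GRing.scale/= mulr1.
    have -> : k^-1 *: (dot w (f (k + x)) - dot w (f x)) - dot w (D x) =
        k^-1 * (dot w (f (k + x)) - dot w (f x) - k * dot w (D x)).
      by rewrite mulrBr mulKf.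
    by rewrite normrM normfV ler_pdivrMl ?normr_gt0// (mulrC _ r).
  apply: DeriveDef; first exact: cvgP cv.
  exact: (cvg_lim _ cv).
- apply/subspace_continuousP => x xst.
  have x01 : x \in `[0, 1] by exact: inn.
  apply/cvgrPdist_le => r r0.
  have /nbhs_ballP[/= q q0 hq] := derivable_within_dot w (df _ x01) ltr01.
  pose m := 1 + `|dot w (D x)|.
  have m0 : 0 < m by rewrite ltr_wpDr.
  apply/nbhs_ballP; exists (Num.min q (r / m)) => /=.
    by rewrite lt_min q0 divr_gt0.
  move=> z; rewrite /ball/= lt_min => /andP[xzq xzr] zst.
  have := hq z xzq (inn _ zst); rewrite mul1r => h.
  rewrite distrC -(subrK ((z - x) * dot w (D x)) (dot w (f z) - _)).
  rewrite (le_trans (ler_normD _ _))// normrM.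
  rewrite (@le_trans _ _ (m * `|z - x|))//.
    by rewrite /m (mulrDl 1) mul1r lerD// mulrC.
  by rewrite mulrC -ler_pdivlMr// distrC ltW.
- rewrite ler_wpM2r ?subr_ge0 ?(ltW st)//.
  rewrite (le_trans (dot_le _ _))//.
  apply: (@le_trans _ _ (1 * M)); last by rewrite mul1r.
  rewrite ler_pM ?enorm_ge0// fM//; apply: inn.
  by move: xst; rewrite !in_itv/= => /andP[/ltW -> /ltW ->].
Unshelve. all: by end_near. Qed.

End speed_bound.

(** * Exhausting the domain by trajectories away from the boundary *)

Section exhaustion.
Context (R : realType) (N : nat).
Local Notation V := 'rV[R]_N.+1.
Local Notation L := (lebesgue_rV R N).
Local Notation mu := (@lebesgue R N : {measure set L -> \bar R}).
Variable Omega : set V.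

(** Bounded sets at positive distance from the complement of Omega, with room for
    two mollifications of radius 1 / (j + 1). *)
Definition inner (j : nat) : set V :=
  [set y | forall z, `|z - y| < 2 / j.+1%:R -> Omega z] `&` [set y | `|y| <= j%:R].

Lemma inner_sub j : inner j `<=` Omega.
Proof. by move=> y [yO _]; apply: yO; rewrite subrr normr0. Qed.

Lemma measurable_inner j : measurable (inner j : set L).
Proof.
apply: measurableI.
  rewrite (_ : [set y | _] = ~` \bigcup_(z in ~` Omega) ball z (2 / j.+1%:R)).
    apply/measurableC/measurable_open/bigcup_open => z _; exact: ball_open.
  apply/seteqP; split => y /=.
    move=> yO [z /= zO]; rewrite -ball_normE/= => zy; exact: zO (yO z zy).
  move=> h z zy; apply: contrapT => zO; apply: h; exists z => //.
  by rewrite -ball_normE.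
have mn : measurable_fun [set: L] (fun y : L => `|y : V|).
  by apply: measurable_continuous => y; exact: norm_continuous.
rewrite (_ : [set y | _] = [set: L] `&` (fun y : L => `|y : V|) @^-1` `]-oo, j%:R]).
  by apply: mn; [exact: measurableT|exact: measurable_itv].
by rewrite setTI; apply/seteqP; split => y /=; rewrite in_itv.
Qed.

Lemma inner_nondecreasing j k : (j <= k)%N -> inner j `<=` inner k.
Proof.
move=> jk y [yO yj]; split; last by rewrite /= (le_trans yj)// ler_nat.
move=> z zy; apply: yO; apply: lt_le_trans zy _.
by rewrite ler_pM2l// lef_pV2 ?posrE// ler_nat.
Qed.

(** Compactness of [0, 1]: locally in time the path keeps a fixed distance from
    the complement of Omega. *)
Lemma path_in_inner (f : R -> V) (M : R) : open Omega ->
    (forall s, s \in `[0, 1] -> Omega (f s)) ->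
    (forall s t, 0 <= s -> s <= t -> t <= 1 -> enorm (f t - f s) <= M * (t - s)) ->
  exists j, forall s, s \in `[0, 1] -> inner j (f s).
Proof.
move=> oO fO fM.
have fM' s t : s \in `[0, 1] -> t \in `[0, 1] ->
    `|f t - f s| <= `|M| * `|t - s|.
  rewrite !in_itv/= => /andP[s0 s1] /andP[t0 t1].
  apply: le_trans (norm_le_enorm _) _.
  wlog st : s t s0 s1 t0 t1 / s <= t => [wl|].
    have [st|/ltW ts] := leP s t; first exact: wl.
    by rewrite -enormN opprB distrC; exact: wl.
  apply: le_trans (fM _ _ s0 st t1) _.
  by rewrite (ger0_norm (_ : 0 <= t - s)) ?subr_ge0// ler_wpM2r ?subr_ge0// ler_norm.
have c01 : compact `[0 : R, 1]%classic by exact: segment_compact.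
have [] := (compact_near_coveringP `[0 : R, 1]%classic).1 c01 nat \oo
  (fun j s => s \in `[0, 1] -> inner j (f s)) _; last first.
  by move=> j _ hj; exists j => s s01; exact: (hj j (leqnn j) s s01).
move=> s /= s01.
have /nbhs_ballP[q /= q0 qO] : nbhs (f s) Omega.
  by apply: open_nbhs_nbhs; split => //; exact: fO.
have m0 : 0 < `|M| + 1 by rewrite ltr_wpDl.
pose p := q / 2 / (`|M| + 1).
have p0 : 0 < p by rewrite !divr_gt0.
(* |f s| + q bounds the path near s, and j > 4 / q gives 2 / (j + 1) < q / 2 *)
pose n0 := Num.bound (`|f s| + q + 4 / q).
exists (ball s p, [set j | (n0 <= j)%N]).
  by split; [exact: nbhsx_ballx|exists n0].
move=> [t j] [/= st jn] t01.
have jb : `|f s| + q + 4 / q < j%:R.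
  apply: lt_le_trans (archi_boundP _) _; last by rewrite ler_nat.
  by rewrite !addr_ge0// ?divr_ge0// ltW.
have ft : `|f t - f s| <= q / 2.
  apply: le_trans (fM' _ _ s01 t01) _.
  apply: (@le_trans _ _ ((`|M| + 1) * p)).
    by rewrite ler_pM// ?lerDl// distrC ltW.
  by rewrite /p mulrC divfK// gt_eqF.
split => [z zt|/=].
  apply: qO; rewrite -ball_normE/= distrC -(subrKA (f t)).
  rewrite (le_lt_trans (ler_normD _ _))// [ltRHS](splitr q) ltr_leD//.
  apply: lt_le_trans zt _; rewrite ler_pdivrMr// mulrAC ler_pdivlMr//.
  have : 4 / q <= j.+1%:R.
    rewrite (@le_trans _ _ j%:R) ?ler_nat// (le_trans _ (ltW jb))//.
    by rewrite lerDr addr_ge0// ltW.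
  by rewrite ler_pdivrMr// mulrC -natrM.
rewrite -(subrK (f s) (f t)) (le_trans (ler_normD _ _))//.
rewrite (le_trans _ (ltW jb))// addrC -addrA lerD2l.
rewrite (le_trans ft)// -[leLHS]addr0 lerD//; last by rewrite divr_ge0// ltW.
by rewrite ler_pdivrMr// ler_pMr// ler1n.
Qed.

End exhaustion.

Section mass_positive.
Context (R : realType) (N : nat).
Local Notation V := 'rV[R]_N.+1.
Local Notation L := (lebesgue_rV R N).
Local Notation mu := (@lebesgue R N : {measure set L -> \bar R}).

(** A kernel without mass makes all balls of radius e null, and countably many of
    them, centred at rational points, cover the space. *)
Lemma mass_eq0 (e : R) : 0 < e -> e <= 1 -> mass N e = 0 -> mu setT = 0%E.
Proof.
move=> e0 e1 m0; have e0' := ltW e0.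
pose B (x : V) : set L := [set y : V | enorm (x - y) < e].
have B0 x : mu.-negligible (B x).
  have mx : measurable_fun setT (EFin \o (fun y : L => moll e (x - (y : V)))).
    apply/measurable_EFinP; apply: measurable_moll => i; exact: measurable_coordB.
  have : (\int[mu]_y `|(EFin \o (fun y : L => moll e (x - (y : V)))) y| = 0)%E.
    under eq_integral do rewrite /= ger0_norm ?moll_ge0//.
    by rewrite integral_mollBr// m0.
  move/(ae_eq_integral_abs mu measurableT mx); apply: negligibleS => y /= By h.
  have := h I; rewrite /= => -[/eqP]; apply/negP.
  by rewrite gt_eqF// exprn_gt0// pospart_gt0.
pose F (n : nat) : set L :=
  if unpickle n is Some q then B (\row_i ratr ((q : 'rV[rat]_N.+1) 0 i)) else set0.
have F0 n : mu.-negligible (F n).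
  by rewrite /F; case: (unpickle n) => [q|]; [exact: B0|exact: negligible_set0].
apply/(negligibleP mu measurableT).
apply: negligibleS (negligible_bigcup F0) => y _.
(* the Euclidean norm is at most N + 1 times the maximum norm *)
have d0 : 0 < e / N.+1%:R / 2 by rewrite !divr_gt0.
have /choice[q qy] i : exists q, `|ratr q - y 0 i| < e / N.+1%:R / 2.
  have /rat_in_itvoo[q /itvP qx] : y 0 i < y 0 i + e / N.+1%:R / 2 by rewrite ltrDl.
  exists q; rewrite ltr_distl qx andbT.
  by rewrite (@lt_trans _ _ (y 0 i)) ?qx// gtrBl.
exists (pickle (\row_i q i)) => //; rewrite /F pickleK /B /=.
apply: le_lt_trans (enorm_le_norm _) _.
apply: (@le_lt_trans _ _ (N.+1%:R * (e / N.+1%:R / 2))).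
  rewrite ler_pM2l//; apply: rV_norm_le => [|i]; first exact: ltW.
  by rewrite !mxE ltW.
by rewrite mulrA (mulrC N.+1%:R) divfK// gtr_pMr// invf_lt1// ltr1n.
Qed.

End mass_positive.

(** * Mollified functions along the trajectories *)

Section flow.
Context (R : realType) (N : nat).
Local Notation V := 'rV[R]_N.+1.
Local Notation L := (lebesgue_rV R N).
Local Notation mu := (@lebesgue R N : {measure set L -> \bar R}).
Variables (Omega : set V) (u : V -> R) (Phi : R -> V -> V) (c M : R).
Hypothesis oO : open Omega.
Hypothesis ui : mu.-integrable (Omega : set L) (EFin \o u).
Hypothesis PO : forall s, s \in `[0, 1] -> set_fun Omega Omega (Phi s).
Hypothesis mP : forall s, s \in `[0, 1] ->
  measurable_fun (Omega : set L) (Phi s : L -> L).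
Hypotheses (c0 : 0 <= c) (M0 : 0 <= M).
Hypothesis Pc : forall s (A : set L), s \in `[0, 1] -> measurable A ->
  A `<=` Omega -> (mu (Omega `&` Phi s @^-1` A) <= c%:E * mu A)%E.
Hypothesis PM : forall x s t, Omega x -> 0 <= s -> s <= t -> t <= 1 ->
  enorm (Phi t x - Phi s x) <= M * (t - s).

Let mO : measurable (Omega : set L). Proof. exact: measurable_open. Qed.

Lemma integral_Phi_le s (F : V -> \bar R) : s \in `[0, 1] ->
    measurable_fun setT (F : L -> \bar R) -> (forall x, (0 <= F x)%E) ->
  (\int[mu]_(x in (Omega : set L)) F (Phi s x) <=
   c%:E * \int[mu]_(x in (Omega : set L)) F x)%E.
Proof.
move=> s01 mF F0.
apply: (@integral_comp_le _ L R mu Omega (Phi s) c F mO) => //.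
- exact: PO.
- exact: mP.
- by move=> A mA AO; exact: Pc.
Qed.

Lemma measurable_Phi s (F : V -> R) : s \in `[0, 1] ->
  measurable_fun setT (F : L -> R) ->
  measurable_fun (Omega : set L) (fun x : L => F (Phi s x)).
Proof. by move=> s01 mF; exact: (measurableT_comp mF (mP s01)). Qed.

Let tk (n k : nat) : R := k%:R / n.+1%:R.

Let tk01 n k : (k <= n.+1)%N -> tk n k \in `[0, 1].
Proof.
move=> kn; rewrite in_itv/= divr_ge0//=.
by rewrite ler_pdivrMr// mul1r ler_nat.
Qed.

(** The points whose trajectory stays in inner Omega j. Looking at rational times
    only makes this a countable intersection of measurable sets. *)
Definition stay (j : nat) : set V := \bigcap_n \bigcap_(k in [set k | (k < n.+2)%N])
  (Omega `&` Phi (k%:R / n.+1%:R) @^-1` inner Omega j).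

Lemma measurable_stay j : measurable (stay j : set L).
Proof.
apply: bigcapT_measurable => n; apply: bigcap_measurable; first by exists 0%N.
move=> k kn; apply: mP; [exact: tk01|exact: mO|exact: measurable_inner].
Qed.

Lemma stay_sub j : stay j `<=` Omega.
Proof. by move=> x /(_ 0%N I 0%N isT)[]. Qed.

Lemma stay_inner j x n k : stay j x -> (k <= n.+1)%N -> inner Omega j (Phi (tk n k) x).
Proof. by move=> jx kn; have [] := jx n I k kn. Qed.

Lemma stay_nondecreasing : nondecreasing_seq stay.
Proof.
move=> j k jk; apply/subsetPset => x jx n _ l ln; have [Ox Px] := jx n I l ln.
by split => //; exact: inner_nondecreasing jk _ Px.
Qed.

Lemma bigcup_stay : \bigcup_j stay j = Omega.
Proof.
apply/seteqP; split => [x [j _ /stay_sub//]|x Ox].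
have [j xj] := @path_in_inner R N Omega (Phi ^~ x) M oO (fun s s01 => PO s01 Ox)
  (fun s t => PM Ox).
by exists j => // n _ k kn; split => //; apply: xj; exact: tk01.
Qed.

Lemma stay_lty j : (mu (stay j) < +oo)%E.
Proof.
have s0 : (0 : R) \in `[0, 1] by rewrite in_itv/= lexx ler01.
have I0 : (mu (inner Omega j) < +oo)%E.
  apply: le_lt_trans (lebesgue_box_lty (\row__ - (j%:R + 1), \row__ (j%:R + 1))).
  apply: le_measure; rewrite ?inE; [exact: measurable_inner|exact: measurable_box|].
  by move=> y [_ yj]; apply: cube_norm; rewrite (le_lt_trans yj)// ltrDl.
apply: (@le_lt_trans _ _ (c%:E * mu (inner Omega j))%E).
  apply: le_trans (Pc s0 (@measurable_inner R N Omega j) (@inner_sub R N Omega j)).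
  apply: le_measure; rewrite ?inE; [exact: measurable_stay| |].
    by apply: mP => //; exact: measurable_inner.
  move=> x jx; split; first exact: stay_sub jx.
  by have := stay_inner (n := 0) (k := 0) jx isT; rewrite /tk mul0r.
by apply: lte_mul_pinfty => //; rewrite ge0_fin_numE.
Qed.

Section mollified.
Variables (j : nat) (e : R).
Hypotheses (e0 : 0 < e) (e1 : e <= 1) (ej : e <= j.+1%:R^-1).
Hypothesis k0 : 0 < mass N e.

Let uu := u \_ Omega.
Let uui : mu.-integrable setT (EFin \o uu : L -> \bar R).
Proof. exact: integrable_extension. Qed.
Let e0' : 0 <= e. Proof. exact: ltW. Qed.

Let U := mollify e uu.
Let G (y : V) : R := enorm (dmollify e uu y).
Let W := \int[mu]_z `|uu z|.

Let W0 : 0 <= W. Proof. exact: Rintegral_ge0. Qed.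

Let mG : measurable_fun setT (G : L -> R).
Proof.
apply: measurable_enorm => i.
exact: (measurable_continuous (dmollify_coord_continuous e0' e1 uui (i:=i))).
Qed.

Let mU : measurable_fun setT (U : L -> R).
Proof. exact: (measurable_continuous (mollify_continuous e0' e1 uui)). Qed.

Let step_le y h (r : R) : enorm h <= r -> r <= 1 ->
  `|U (y + h) - U y| <= r * G y + 27 * W * r ^+ 2.
Proof.
move=> hr r1; have h1 := le_trans hr r1.
have := mollify_taylor e0' e1 uui y h1; rewrite -/U -/W => ht.
have hd := dot_norm_le (dmollify e uu y) h.
have h0 := enorm_ge0 h; have g0 := enorm_ge0 (dmollify e uu y).
rewrite -(subrK (dot (dmollify e uu y) h) (U (y + h) - U y)).
rewrite (le_trans (ler_normD _ _))// addrC lerD//.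
  by rewrite (le_trans hd)// mulrC ler_wpM2r.
rewrite (le_trans ht)// mulrAC ler_wpM2l ?mulr_ge0//.
by rewrite ler_pXn2r// nnegrE// (le_trans h0).
Qed.

(** Taylor expansion along the time grid: each of the n + 1 steps has length at
    most M / (n + 1). *)
Let path_le n x : stay j x -> M / n.+1%:R <= 1 ->
  `|U (Phi 1 x) - U (Phi 0 x)| <=
  \sum_(0 <= k < n.+1) (M / n.+1%:R * (G (Phi (tk n k) x) * \1_(inner Omega j) (Phi (tk n k) x))
    + 27 * W * (M / n.+1%:R) ^+ 2).
Proof.
move=> jx Mn.
have -> : U (Phi 1 x) - U (Phi 0 x) =
    \sum_(0 <= k < n.+1) (U (Phi (tk n k.+1) x) - U (Phi (tk n k) x)).
  rewrite (telescope_sumr (fun k => U (Phi (tk n k) x)) (leq0n n.+1)).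
  by have [-> ->] : tk n n.+1 = 1 /\ tk n 0 = 0 by rewrite /tk divff// mul0r.
apply: (le_trans (ler_norm_sum _ _ _)); rewrite big_nat [leRHS]big_nat.
apply: ler_sum => k /andP[_ kn].
rewrite indicE mem_set; last by apply: stay_inner => //; exact: ltnW.
rewrite mulr1.
have dt : tk n k.+1 - tk n k = n.+1%:R^-1.
  by rewrite /tk -mulrBl -natrB// subSnn mul1r.
have := tk01 kn; have := tk01 (ltnW kn); rewrite !in_itv/= => /andP[s0 s1] /andP[t0 t1].
have hs : enorm (Phi (tk n k.+1) x - Phi (tk n k) x) <= M / n.+1%:R.
  rewrite -dt; apply: PM => //; first exact: stay_sub jx.
  by rewrite -subr_ge0 dt invr_ge0.
by have := step_le (Phi (tk n k) x) hs Mn; rewrite (addrC (Phi (tk n k) x)) subrK.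
Qed.

(** The first-order terms of path_le add up to M times an average over the grid
    of integrals of |grad U| (Phi s x), each bounded by c times the integral of
    |grad U| over inner Omega j. The remainders add up to O(1 / n), since stay j
    has finite measure. *)
Lemma integral_mollify_flow_le :
  (\int[mu]_(x in (stay j : set L)) (`|U (Phi 1 x) - U (Phi 0 x)|)%:E <=
   (M * c)%:E * ((mass N e)%:E * Defs.total_variation Omega u))%E.
Proof.
set B := ((mass N e)%:E * Defs.total_variation Omega u)%E.
have mj := measurable_stay j.
have mI := @measurable_inner R N Omega j.
pose H (y : V) : R := G y * \1_(inner Omega j) y.
have mH : measurable_fun setT (H : L -> R).
  by apply: measurable_funM; [exact: mG|exact: (@measurable_indic _ L R setT _ mI)].
have H0 y : 0 <= H y by rewrite mulr_ge0 ?enorm_ge0.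
have HB : (\int[mu]_(y in (Omega : set L)) (H y)%:E <= B)%E.
  have -> : (\int[mu]_(y in (Omega : set L)) (H y)%:E =
      \int[mu]_(y in (inner Omega j : set L)) (G y)%:E)%E.
    rewrite integral_mkcond [RHS]integral_mkcond; apply: eq_integral => y _.
    rewrite !patchE /H indicE; have [yj|yj] := pselect (inner Omega j y).
      by rewrite !mem_set ?mulr1//; exact: inner_sub yj.
    by rewrite (memNset yj) mulr0; case: ifP.
  apply: (@mollify_gradient_le R N Omega u (inner Omega j) e j%:R oO ui mI) => //.
  - by move=> y [].
  - move=> y z [yO _] zy; apply: yO; apply: lt_le_trans zy _.
    by rewrite ler_pM2l.
have B0 : (0 <= B)%E.
  by apply: le_trans HB; apply: integral_ge0 => y _; rewrite lee_fin.
have HE s : s \in `[0, 1] ->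
    (\int[mu]_(x in (stay j : set L)) (H (Phi s x))%:E <= c%:E * B)%E.
  move=> s01; apply: (@le_trans _ _ (\int[mu]_(x in (Omega : set L)) (H (Phi s x))%:E)%E).
    apply: (@ge0_subset_integral _ L R mu _ _ mj mO); last exact: stay_sub.
    - apply/measurable_EFinP; exact: measurable_Phi.
    - by move=> x _; rewrite lee_fin.
  apply: le_trans (@integral_Phi_le s (EFin \o H) s01 _ _) _.
  - exact/measurable_EFinP.
  - by move=> x; rewrite lee_fin.
  - by apply: lee_wpmul2l => //; rewrite lee_fin.
apply/lee_addgt0Pr => r r0.
pose l := fine (mu (stay j)).
have l0 : 0 <= l by apply: fine_ge0.
(* the first summand ensures M / (n + 1) <= 1, the second makes the sum of all
   remainders at most r *)
pose n := Num.bound (M + 27 * W * M ^+ 2 * l / r).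
have Kb : 0 <= 27 * W * M ^+ 2 * l.
  by rewrite mulr_ge0// mulr_ge0 ?sqr_ge0// mulr_ge0.
have nb : M + 27 * W * M ^+ 2 * l / r < n.+1%:R.
  apply: lt_trans (archi_boundP _) _; last by rewrite ltr_nat.
  by rewrite addr_ge0// divr_ge0// ltW.
have Mn : M / n.+1%:R <= 1.
  rewrite ler_pdivrMr// mul1r (le_trans _ (ltW nb))// lerDl divr_ge0//.
  exact: ltW.
pose m := M / n.+1%:R.
have m0 : 0 <= m by rewrite divr_ge0.
pose T k (x : V) : R := m * H (Phi (tk n k) x) + 27 * W * m ^+ 2.
have WK : 0 <= 27 * W * m ^+ 2 by rewrite mulr_ge0 ?sqr_ge0// mulr_ge0.
have T0 k x : 0 <= T k x by rewrite addr_ge0// mulr_ge0.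
have mT k : (k < n.+1)%N -> measurable_fun (stay j : set L) (T k : L -> R).
  move=> kn; apply: measurable_funD; last exact: measurable_cst.
  apply: measurable_funM; first exact: measurable_cst.
  apply: measurable_funS (measurable_Phi (tk01 (ltnW kn)) mH) => //.
  exact: stay_sub.
have mTs : measurable_fun (stay j : set L)
    ((fun x => \sum_(0 <= k < n.+1) T k x) : L -> R).
  rewrite (_ : (fun _ => _) = (fun x => \sum_(k < n.+1) T k x)).
    by apply: measurable_sum => k; exact: mT.
  by apply/funext => x; rewrite big_mkord.
pose X : \bar R := (m%:E * (c%:E * B) + (27 * W * m ^+ 2 * l)%:E)%E.
have TX k : (k < n.+1)%N -> (\int[mu]_(x in (stay j : set L)) (T k x)%:E <= X)%E.
  move=> kn; have mHk := measurable_funS mO (@stay_sub j) (measurable_Phi (tk01 (ltnW kn)) mH).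
  rewrite /T; under eq_integral do rewrite EFinD.
  rewrite ge0_integralD; last 5 first.
  - exact: mj.
  - by move=> x _; rewrite lee_fin mulr_ge0.
  - by apply/measurable_EFinP; apply: measurable_funM; [exact: measurable_cst|exact: mHk].
  - by move=> x _; rewrite lee_fin.
  - exact: measurable_cst.
  apply: leeD.
    under eq_integral do rewrite EFinM.
    rewrite ge0_integralZl_EFin; last 4 first.
    - exact: mj.
    - by move=> x _; rewrite lee_fin.
    - by apply/measurable_EFinP; exact: mHk.
    - by [].
    by apply: lee_wpmul2l; [rewrite lee_fin|apply: HE; exact: tk01 (ltnW kn)].
  rewrite integral_cst// EFinM /l fineK// ge0_fin_numE//.
  exact: stay_lty.
apply: (@le_trans _ _ (\sum_(0 <= k < n.+1) X)%E).
  apply: (@le_trans _ _ (\int[mu]_(x in (stay j : set L)) (\sum_(0 <= k < n.+1) T k x)%:E)%E).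
    apply: ge0_le_integral; first exact: mj.
    - by move=> x _; rewrite lee_fin.
    - apply/measurable_EFinP; apply: (measurableT_comp (@normr_measurable R setT)).
      apply: (measurable_funS mO (@stay_sub j)).
      by apply: measurable_funB; apply: measurable_Phi => //; rewrite in_itv/= lexx ler01.
    - apply/measurable_EFinP; exact: mTs.
    - by move=> x jx; rewrite lee_fin; exact: path_le.
  rewrite (_ : (\int[mu]_(x in _) _)%E =
      (\sum_(0 <= k < n.+1) \int[mu]_(x in (stay j : set L)) (T k x)%:E)%E).
    by rewrite big_nat [leRHS]big_nat; apply: lee_sum => k /andP[_ kn]; exact: TX.
  rewrite big_mkord; under eq_integral do rewrite big_mkord -sumEFin.
  apply: ge0_integral_sum; first exact: mj.
    by move=> k; apply/measurable_EFinP; exact: mT.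
  by move=> k x _; rewrite lee_fin.
have -> : (\sum_(0 <= k < n.+1) X = n.+1%:R%:E * X)%E.
  by rewrite mule_natl sumr_const_nat subn0.
rewrite /X ge0_muleDr; last 2 first.
- by apply: mule_ge0; [rewrite lee_fin|apply: mule_ge0; [rewrite lee_fin|exact: B0]].
- by rewrite lee_fin mulr_ge0.
rewrite muleA -EFinM (mulrC n.+1%:R) divfK// muleA -EFinM leeD2l//.
rewrite -EFinM lee_fin /m expr_div_n.
rewrite (_ : n.+1%:R * _ = 27 * W * M ^+ 2 * l / n.+1%:R); last first.
  have : n.+1%:R != 0 :> R by rewrite pnatr_eq0.
  by move: (n.+1%:R) => q q0; field.
rewrite ler_pdivrMr// (mulrC r) -ler_pdivrMr// (le_trans _ (ltW nb))//.
by rewrite lerDr.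
Qed.

End mollified.

End flow.

(** * Functions of bounded variation along the trajectories *)

Section variation_along_flow.
Context (R : realType) (N : nat).
Local Notation V := 'rV[R]_N.+1.
Local Notation L := (lebesgue_rV R N).
Local Notation mu := (@lebesgue R N : {measure set L -> \bar R}).
Variables (Omega : set V) (u : V -> R) (Phi : R -> V -> V) (c M : R).
Hypothesis oO : open Omega.
Hypothesis ui : mu.-integrable (Omega : set L) (EFin \o u).
Hypothesis PO : forall s, s \in `[0, 1] -> set_fun Omega Omega (Phi s).
Hypothesis mP : forall s, s \in `[0, 1] ->
  measurable_fun (Omega : set L) (Phi s : L -> L).
Hypotheses (c0 : 0 <= c) (M0 : 0 <= M).
Hypothesis Pc : forall s (A : set L), s \in `[0, 1] -> measurable A ->
  A `<=` Omega -> (mu (Omega `&` Phi s @^-1` A) <= c%:E * mu A)%E.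
Hypothesis PM : forall x s t, Omega x -> 0 <= s -> s <= t -> t <= 1 ->
  enorm (Phi t x - Phi s x) <= M * (t - s).

(** Test with the zero field. *)
Lemma BV_variation_ge0 : (0 <= Defs.total_variation Omega u)%E.
Proof.
apply: ereal_sup_ubound; exists (cst 0) => /=.
  split; last by move=> x; rewrite enorm0.
  have s0 : [set x : V | (cst 0 : V -> V) x != 0] = set0.
    by apply/seteqP; split => x //=; rewrite eqxx.
  split.
  - by move=> i x; exact: derivable_cst.
  - move=> i; rewrite (_ : 'D_(delta_mx 0 i) (cst 0 : V -> V) = cst 0).
      exact: cst_continuous.
    by apply/funext => y; exact: derive_cst.
  - by rewrite s0 closure0; exact: compact0.
  - by rewrite s0 closure0.
apply: integral0_eq => x _.
rewrite /divergence big1 ?mulr0// => i _.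
by rewrite derive_cst mxE.
Qed.

Let mO : measurable (Omega : set L). Proof. exact: measurable_open. Qed.

Let uu := u \_ Omega.
Let uui : mu.-integrable setT (EFin \o uu : L -> \bar R).
Proof. exact: integrable_extension. Qed.

Let muu : measurable_fun setT (uu : L -> R).
Proof. exact: ((measurable_EFinP _ _).1 (measurable_int mu uui)). Qed.

Let s0 : (0 : R) \in `[0, 1]. Proof. by rewrite in_itv/= lexx ler01. Qed.
Let s1 : (1 : R) \in `[0, 1]. Proof. by rewrite in_itv/= ler01 lexx. Qed.

Let D x : R := `|uu (Phi 1 x) - uu (Phi 0 x)|.

Let mD : measurable_fun (Omega : set L) (D : L -> R).
Proof.
apply: (measurableT_comp (@normr_measurable R setT)).
by apply: measurable_funB; exact: (measurable_Phi mP).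
Qed.

Let stay_le (m0 : forall e : R, 0 < e -> e <= 1 -> 0 < mass N e) (j : nat) :
  (\int[mu]_(x in (stay Omega Phi j : set L)) (D x)%:E <=
   (M * c)%:E * Defs.total_variation Omega u)%E.
Proof.
set E := stay Omega Phi j.
have mE : measurable (E : set L) := measurable_stay oO mP j.
have EO : E `<=` Omega by exact: stay_sub.
apply/lee_addgt0Pr => r r0.
have c2 : 0 < 2 * c + 1 by rewrite ltr_wpDl// mulr_ge0.
(* the L^1 error of the mollification enters twice, each time with a factor c *)
have [_ /(_ _ (divr_gt0 r0 c2))[s sp es]] := integrable_mollifiable uui.
pose e := Num.min s j.+1%:R^-1.
have e0 : 0 < e by rewrite lt_min sp invr_gt0 ltr0n.
have ej : e <= j.+1%:R^-1 by rewrite ge_min lexx orbT.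
have e1 : e <= 1 by rewrite (le_trans ej)// invf_le1// ler1n.
have k0 := m0 e e0 e1.
have {}es : mollify_err e uu <= mass N e * (r / (2 * c + 1)).
  by apply: es => //; rewrite ge_min lexx.
have e0' := ltW e0.
pose U := mollify e uu.
have mU : measurable_fun setT (U : L -> R).
  exact: (measurable_continuous (mollify_continuous e0' e1 uui)).
pose F (y : V) : R := `|U y - mass N e * uu y|.
have F0 y : 0 <= F y by exact: normr_ge0.
have mF : measurable_fun setT (F : L -> R).
  apply: (measurableT_comp (@normr_measurable R setT)).
  apply: measurable_funB; first exact: mU.
  by apply: measurable_funM; [exact: measurable_cst|exact: muu].
have errF : (\int[mu]_y (F y)%:E <= (mass N e * (r / (2 * c + 1)))%:E)%E.
  by rewrite -EFin_L1n ?lee_fin//; exact: mollify_err_integrable.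
have FE t : t \in `[0, 1] ->
    (\int[mu]_(x in (E : set L)) (F (Phi t x))%:E <=
     (c * (mass N e * (r / (2 * c + 1))))%:E)%E.
  move=> t01.
  apply: (@le_trans _ _ (\int[mu]_(x in (Omega : set L)) (F (Phi t x))%:E)%E).
    apply: (@ge0_subset_integral _ L R mu _ _ mE mO); last exact: EO.
    - apply/measurable_EFinP; exact: (measurable_Phi mP).
    - by move=> x _; rewrite lee_fin.
  apply: le_trans (@integral_Phi_le R N Omega Phi c oO PO mP c0 Pc t (EFin \o F) t01 _ _) _.
  - by apply/measurable_EFinP; exact: mF.
  - by move=> x; rewrite /= lee_fin normr_ge0.
  rewrite EFinM; apply: lee_wpmul2l; first by rewrite lee_fin.
  apply: le_trans errF.
  apply: (@ge0_subset_integral _ L R mu _ _ mO measurableT); last by [].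
  - by apply/measurable_EFinP; exact: mF.
  - by move=> x _; rewrite lee_fin.
pose H x : R := `|U (Phi 1 x) - U (Phi 0 x)|.
have HE := integral_mollify_flow_le oO ui PO mP c0 M0 Pc PM e0 e1 ej k0.
have mEs (G : V -> R) : measurable_fun (Omega : set L) (G : L -> R) ->
    measurable_fun (E : set L) (EFin \o G : L -> \bar R).
  by move=> mG; apply/measurable_EFinP; exact: (measurable_funS mO EO).
have mFt t : t \in `[0, 1] ->
    measurable_fun (E : set L) (fun x : L => (F (Phi t x))%:E).
  by move=> t01; apply: (mEs (fun x => F (Phi t x))); exact: (measurable_Phi mP).
have mH : measurable_fun (E : set L) (fun x : L => (H x)%:E).
  apply: mEs; apply: (measurableT_comp (@normr_measurable R setT)).
  by apply: measurable_funB; exact: (measurable_Phi mP).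
have key : ((mass N e)%:E * \int[mu]_(x in (E : set L)) (D x)%:E <=
    \int[mu]_(x in (E : set L)) (F (Phi 1 x))%:E +
    (\int[mu]_(x in (E : set L)) (H x)%:E +
     \int[mu]_(x in (E : set L)) (F (Phi 0 x))%:E))%E.
  have F0e y : (0 <= (F y)%:E)%E by rewrite lee_fin.
  have H0 y : (0 <= (H y)%:E)%E by rewrite lee_fin normr_ge0.
  have mHF : measurable_fun (E : set L) (fun x : L => (H x)%:E + (F (Phi 0 x))%:E)%E.
    by apply: emeasurable_funD; [exact: mH|exact: mFt].
  rewrite -ge0_integralD; [|exact: mE|by []|exact: mH|by []|exact: mFt].
  rewrite -ge0_integralD; [|exact: mE|by []|exact: mFt| |exact: mHF]; last first.
    by move=> x _; exact: adde_ge0.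
  rewrite -ge0_integralZl_EFin; last 4 first.
  - exact: mE.
  - by move=> x _; rewrite lee_fin normr_ge0.
  - exact: mEs.
  - exact: ltW.
  apply: ge0_le_integral.
  - exact: mE.
  - by move=> x _; rewrite -EFinM lee_fin mulr_ge0 ?normr_ge0// ltW.
  - apply: (mEs (fun x => mass N e * D x)).
    by apply: measurable_funM; [exact: measurable_cst|exact: mD].
  - by apply: emeasurable_funD; [exact: mFt|exact: mHF].
  move=> x _; rewrite -EFinM -!EFinD lee_fin /D /F /H.
  rewrite -[X in X * _](ger0_norm (ltW k0)) -normrM mulrBr.
  set p := mass N e * uu (Phi 1 x); set q := mass N e * uu (Phi 0 x).
  rewrite (_ : p - q = - (U (Phi 1 x) - p) +
    ((U (Phi 1 x) - U (Phi 0 x)) + (U (Phi 0 x) - q))); last by ring.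
  rewrite (le_trans (ler_normD _ _))// normrN lerD2l.
  exact: ler_normD.
have k0e : (0 < (mass N e)%:E)%E by rewrite lte_fin.
rewrite -(@lee_pmul2l _ (mass N e)%:E)//.
apply: (le_trans key).
apply: (le_trans (leeD (FE 1 s1) (leeD HE (FE 0 s0)))).
rewrite ge0_muleDr; last 2 first.
- by apply: mule_ge0; [rewrite lee_fin mulr_ge0|exact: BV_variation_ge0].
- by rewrite lee_fin ltW.
rewrite addeCA (muleCA (M * c)%:E) leeD2l// -EFinD -EFinM lee_fin.
rewrite [leLHS](_ : _ = mass N e * ((2 * c / (2 * c + 1)) * r)); last first.
  by field; rewrite gt_eqF.
rewrite ler_pM2l// ler_piMl ?(ltW r0)// ler_pdivrMr// mul1r lerDl//.
Qed.

(** The heart of the matter: the bound obtained for mollifications passes to the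
    limit on each set stay Omega Phi j, and these sets exhaust Omega. *)
Lemma variation_along_flow_le :
  (\int[mu]_(x in (Omega : set L)) (`|u (Phi 1 x) - u (Phi 0 x)|)%:E <=
   (M * c)%:E * Defs.total_variation Omega u)%E.
Proof.
have -> : (\int[mu]_(x in (Omega : set L)) (`|u (Phi 1 x) - u (Phi 0 x)|)%:E =
    \int[mu]_(x in (Omega : set L)) (D x)%:E)%E.
  apply: eq_integral => x /set_mem Ox; rewrite /D /uu !patchE.
  by rewrite !mem_set//; exact: PO.
have [m0|] := pselect (forall e : R, 0 < e -> e <= 1 -> 0 < mass N e); last first.
  move=> /existsNP[e /not_implyP[e0 /not_implyP[e1 /negP]]].
  rewrite -leNgt => m0.
  have {}m0 : mass N e = 0 by apply/eqP; rewrite eq_le m0 mass_ge0.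
  have muO : mu (Omega : set L) = 0%E.
    apply/eqP; rewrite eq_le measure_ge0 andbT -(mass_eq0 e0 e1 m0).
    by apply: le_measure; rewrite ?inE; [exact: mO|exact: measurableT|].
  have -> : (\int[mu]_(x in (Omega : set L)) (D x)%:E = 0)%E.
    have := integral_abs_eq0 mO ((measurable_EFinP _ _).2 mD) muO.
    by under eq_integral do rewrite /= normr_id.
  by rewrite mule_ge0 ?BV_variation_ge0// lee_fin mulr_ge0.
rewrite -{1}(bigcup_stay oO PO PM).
have cv := @ge0_nondecreasing_set_cvg_integral _ L R (stay Omega Phi) (EFin \o D) mu
  (stay_nondecreasing Omega Phi) (measurable_stay oO mP).
have {}cv : (\int[mu]_(x in (stay Omega Phi i : set L)) (D x)%:E)%E @[i --> \oo] -->
    (\int[mu]_(x in (\bigcup_i stay Omega Phi i : set L)) (D x)%:E)%E.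
  apply: cv => i; last by move=> x _; rewrite lee_fin normr_ge0.
  apply/measurable_EFinP; apply: (measurable_funS mO _ mD); exact: stay_sub.
rewrite -(cvg_lim _ cv)//; apply: lime_le; first exact: cvgP cv.
by apply: nearW => i; exact: stay_le.
Qed.

End variation_along_flow.

Section composition_estimates.
Context (R : realType) (N : nat).
Local Notation V := 'rV[R]_N.+1.
Local Notation L := (lebesgue_rV R N).
Local Notation mu := (@lebesgue R N : {measure set L -> \bar R}).
Variables (Omega : set V) (u : V -> R) (Phi : R -> V -> V) (c : R).
Hypothesis oO : open Omega.

Lemma Lp_norm1E (w : V -> R) :
  Lp_norm Omega 1 w = (\int[mu]_(x in (Omega : set L)) (`|w x|)%:E)%E.
Proof.
rewrite /Lp_norm Lnorm1 [RHS]integral_mkcond; apply: eq_integral => x _.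
by rewrite !patchE; case: ifP => // _; rewrite abse0.
Qed.

Hypothesis ui : mu.-integrable (Omega : set L) (EFin \o u).
Hypothesis PO : forall s, s \in `[0, 1] -> set_fun Omega Omega (Phi s).
Hypothesis mP : forall s, s \in `[0, 1] ->
  measurable_fun (Omega : set L) (Phi s : L -> L).
Hypothesis c0 : 0 <= c.
Hypothesis Pc : forall s (A : set L), s \in `[0, 1] -> measurable A ->
  A `<=` Omega -> (mu (Omega `&` Phi s @^-1` A) <= c%:E * mu A)%E.

(** A crude bound without any smallness, for the case of infinite speed. *)
Lemma Lp_norm1_comp_le :
  (Lp_norm Omega 1 (fun x => (u (Phi 0 x) - u (Phi 1 x))%R) <=
   c%:E * Lp_norm Omega 1 u + c%:E * Lp_norm Omega 1 u)%E.
Proof.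
have mO : measurable (Omega : set L) := measurable_open oO.
pose uu := u \_ Omega.
have uui : mu.-integrable setT (EFin \o uu : L -> \bar R).
  exact: integrable_extension.
have muu : measurable_fun setT (uu : L -> R).
  exact: ((measurable_EFinP _ _).1 (measurable_int mu uui)).
pose F y : R := `|uu y|.
have F0 y : 0 <= F y := normr_ge0 _.
have mF : measurable_fun setT (F : L -> R).
  exact: (measurableT_comp (@normr_measurable R setT) muu).
have s0 : (0 : R) \in `[0, 1] by rewrite in_itv/= lexx ler01.
have s1 : (1 : R) \in `[0, 1] by rewrite in_itv/= ler01 lexx.
have FL : (\int[mu]_(x in (Omega : set L)) (F x)%:E = Lp_norm Omega 1 u)%E.
  rewrite Lp_norm1E; apply: eq_integral => x Ox.
  by rewrite /F /uu patchE Ox.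
have Fs s : s \in `[0, 1] ->
    (\int[mu]_(x in (Omega : set L)) (F (Phi s x))%:E <= c%:E * Lp_norm Omega 1 u)%E.
  move=> s01; rewrite -FL.
  apply: (@integral_Phi_le R N Omega Phi c oO PO mP c0 Pc s (EFin \o F) s01).
  - by apply/measurable_EFinP; exact: mF.
  - by move=> x; rewrite /= lee_fin.
apply: le_trans (leeD (Fs 0 s0) (Fs 1 s1)).
have mFs s : s \in `[0, 1] -> measurable_fun (Omega : set L)
    (fun x : L => (F (Phi s x))%:E).
  by move=> s01; apply/measurable_EFinP; exact: (measurable_Phi mP).
have F0e y : (0 <= (F y)%:E)%E by rewrite lee_fin.
rewrite -ge0_integralD; [|exact: mO|by []|exact: mFs|by []|exact: mFs].
rewrite Lp_norm1E.
have E x : (Omega : set L) x ->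
    `|u (Phi 0 x) - u (Phi 1 x)| = `|uu (Phi 0 x) - uu (Phi 1 x)|.
  by move=> Ox; rewrite /uu !patchE !mem_set//; exact: PO.
have -> : (\int[mu]_(x in (Omega : set L)) (`|u (Phi 0 x) - u (Phi 1 x)|)%:E =
    \int[mu]_(x in (Omega : set L)) (`|uu (Phi 0 x) - uu (Phi 1 x)|)%:E)%E.
  by apply: eq_integral => x /set_mem Ox; rewrite E.
apply: ge0_le_integral.
- exact: mO.
- by move=> x _; rewrite lee_fin normr_ge0.
- apply/measurable_EFinP; apply: (measurableT_comp (@normr_measurable R setT)).
  by apply: measurable_funB; exact: (measurable_Phi mP).
- by apply: emeasurable_funD; exact: mFs.
- by move=> x _; rewrite -EFinD lee_fin; exact: ler_normB.
Qed.

End composition_estimates.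

Theorem lemma3p1 (R : realType) (N : nat) (Omega : set 'rV[R]_N.+1)
    (phi vphi : 'rV[R]_N.+1 -> 'rV[R]_N.+1) (u : 'rV[R]_N.+1 -> R)
    (Phi : R -> 'rV[R]_N.+1 -> 'rV[R]_N.+1) (c C : R) :
  open Omega ->
  set_fun Omega Omega phi ->
  set_fun Omega Omega vphi ->
  BV Omega u ->
  (forall s, s \in `[0, 1] -> set_fun Omega Omega (Phi s)) ->
  (forall x, Omega x -> Phi 0 x = phi x) ->
  (forall x, Omega x -> Phi 1 x = vphi x) ->
  (forall s, s \in `[0, 1] ->
     measurable_fun (Omega : set (lebesgue_rV R N))
       (Phi s : lebesgue_rV R N -> lebesgue_rV R N)) ->
  (forall s x, s \in `[0, 1] -> Omega x ->
     derivable_within `[0, 1] (Phi ^~ x) s) ->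
  0 <= c -> 0 <= C ->
  (forall s (A : set (lebesgue_rV R N)), s \in `[0, 1] ->
     measurable A -> A `<=` Omega ->
     (lebesgue (Omega `&` Phi s @^-1` A) <= c%:E * lebesgue A)%E) ->
  (ereal_sup [set (enorm (derive_within `[0%R, 1%R] (Phi ^~ sx.2) sx.1))%:E |
              sx in `[0%R, 1%R] `*` Omega]
   <= C%:E * Lp_norm Omega +oo (fun x => enorm (phi x - vphi x)%R))%E ->
  (Lp_norm Omega 1 (fun x => u (phi x) - u (vphi x))%R
   <= c%:E * C%:E * BV_norm Omega u *
      Lp_norm Omega +oo (fun x => enorm (phi x - vphi x)%R))%E.
Proof.
move=> oO phiO vphiO [ui TVoo] PO P0 P1 mP dP c0 C0 Pc supP.
have s0 : (0 : R) \in `[0, 1] by rewrite in_itv/= lexx ler01.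
have s1 : (1 : R) \in `[0, 1] by rewrite in_itv/= ler01 lexx.
set S := Lp_norm Omega +oo _ in supP *.
have S0 : (0 <= S)%E by exact: Lnorm_ge0.
have CS0 : (0 <= C%:E * S)%E by rewrite mule_ge0.
set L1 := Lp_norm Omega 1 _.
have L1E : L1 = Lp_norm Omega 1 (fun x => u (Phi 0 x) - u (Phi 1 x)).
  rewrite /L1 !Lp_norm1E; apply: eq_integral => x /set_mem Ox.
  by rewrite P0// P1.
have TV0 := @BV_variation_ge0 _ _ Omega u.
have u0 : (0 <= Lp_norm Omega 1 u)%E by exact: Lnorm_ge0.
have BV0 : (0 <= BV_norm Omega u)%E by exact: adde_ge0.
rewrite -!muleA (muleCA C%:E) muleA.
have [CSoo|CSfin] := eqVneq (C%:E * S)%E +oo%E.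
  (* as 0 * +oo = 0, the right-hand side is +oo only if c * ||u||_BV > 0 *)
  rewrite CSoo; have [cBV|cBV] := eqVneq (c%:E * BV_norm Omega u)%E 0%E.
    rewrite cBV mul0e L1E.
    apply: le_trans (Lp_norm1_comp_le oO ui PO mP c0 Pc) _.
    have -> : (c%:E * Lp_norm Omega 1 u = 0)%E.
      apply/eqP; rewrite eq_le mule_ge0// andbT -cBV lee_wpmul2l//.
      by rewrite leeDl.
    by rewrite adde0.
  by rewrite gt0_muley ?leey// lt0e cBV mule_ge0.
pose M := fine (C%:E * S)%E.
have ME : M%:E = (C%:E * S)%E.
  by rewrite fineK// ge0_fin_numE// lt_neqAle CSfin leey.
have M0 : 0 <= M by rewrite fine_ge0.
have speed x s : Omega x -> s \in `[0, 1] ->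
    enorm (derive_within `[0, 1] (Phi ^~ x) s) <= M.
  move=> Ox s01; rewrite -lee_fin ME; apply: le_trans supP.
  by apply: ereal_sup_ubound; exists (s, x).
have PM x s t : Omega x -> 0 <= s -> s <= t -> t <= 1 ->
    enorm (Phi t x - Phi s x) <= M * (t - s).
  move=> Ox; apply: (@speed_lipschitz R N (Phi ^~ x) M) => r r01.
    exact: dP.
  exact: speed.
have := variation_along_flow_le oO ui PO mP c0 M0 Pc PM.
rewrite L1E Lp_norm1E -ME => VF.
have -> : (\int[lebesgue]_(x in (Omega : set (lebesgue_rV R N)))
      (`|u (Phi 0 x) - u (Phi 1 x)|)%:E =
    \int[lebesgue]_(x in (Omega : set (lebesgue_rV R N)))
      (`|u (Phi 1 x) - u (Phi 0 x)|)%:E)%E.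
  by apply: eq_integral => x _; rewrite distrC.
apply: (le_trans VF); rewrite EFinM -(muleA M%:E) (muleC M%:E).
apply: lee_wpmul2r; first by rewrite lee_fin.
apply: lee_wpmul2l; first by rewrite lee_fin.
by rewrite leeDr.
Qed.
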